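(* Let $n,m\ge 1$ and $k_1,\dots,k_m\ge 1$ be integers. Let $\mathcal{N}$ be the set of functions $\mathbb{R}^n\to\mathbb{R}^m$ represented by a layer of $m$ maxout units of ranks $k_1,\dots,k_m$ with $n$ inputs (with biases). Then $$N(\mathcal{N})=\sum_{j=0}^{n}\ \sum_{S\in\binom{[m]}{j}}\ \prod_{i\in S}(k_i-1).$$ In particular, if $k_1=\cdots=k_m=k$, then $N(\mathcal{N})=\sum_{j=0}^{n}\binom{m}{j}(k-1)^j$. Moreover, if $\mathcal{N}_0$ is the set of functions represented by the same layer without biases, then $$N(\mathcal{N}_0)=\binom{m'-1}{n-1}+\sum_{j=0}^{n-1}\ \sum_{S\in\binom{[m]}{j}}\ \prod_{i\in S}(k_i-1),$$ where $m'$ is the number of units of rank larger than $1$. In particular, if $k_1=\cdots=k_m=k>1$, then $N(\mathcal{N}_0)=\binom{m-1}{n-1}+\sum_{j=0}^{n-1}\binom{m}{j}(k-1)^j$.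
   Context: A rank-$k$ maxout unit with $n$ inputs is a function $\mathbb{R}^n\to\mathbb{R}$, $x\mapsto\max\{\langle A_1,x\rangle+b_1,\dots,\langle A_k,x\rangle+b_k\}$, with parameters $A_r\in\mathbb{R}^n$ (weights) and $b_r\in\mathbb{R}$ (biases). A layer with $n$ inputs and $m$ maxout units of ranks $k_1,\dots,k_m$ is a function $\mathbb{R}^n\to\mathbb{R}^m$ whose $j$th coordinate is a rank-$k_j$ maxout unit; $\mathcal{N}$ is the set of all such functions over all choices of parameters. ''Without biases'' means all $b_r$ are $0$. For a continuous piecewise (affine) linear function $f$ on $\mathbb{R}^{n}$, the nonlinear locus $V(f)$ is the set of points at which the gradient (Jacobian) of $f$ is discontinuous (i.e. $f$ is not locally affine); a linear region of $f$ is a connected component of $\mathbb{R}^n\setminus V(f)$; $N(f)$ is the number of linear regions, and $N(\mathcal{N})=\max_{f\in\mathcal{N}}N(f)$. $[m]=\{1,\dots,m\}$, and $\binom{[m]}{j}$ is the set of subsets of $[m]$ of cardinality $j$ (so $\binom{[m]}{0}=\{\emptyset\}$). Empty sums are $0$, empty products are $1$. Binomial coefficients $\binom{a}{b}$ with $b\ge 0$ and $a<b$ are $0$ (including $a=-1$). *)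

(* Defs.v *)
From HB Require Import structures.
From mathcomp Require Import all_boot all_order all_algebra.
From mathcomp Require Import all_classical all_reals all_analysis.

Set Implicit Arguments.
Unset Strict Implicit.
Unset Printing Implicit Defensive.

Import Order.TTheory GRing.Theory Num.Theory.
Import numFieldNormedType.Exports.

Local Open Scope classical_set_scope.
Local Open Scope ring_scope.

(* The supremum of a finite nonempty family is its maximum; all uses below
   assume k > 0. *)
Definition maxout_unit (R : realType) (n k : nat)
    (A : 'M[R]_(k, n)) (b : 'rV[R]_k) (x : 'rV[R]_n) : R :=
  sup [set (\sum_(i < n) A r i * x 0 i) + b 0 r | r in [set: 'I_k]].

Definition maxout_layer (R : realType) (n m : nat) (k : 'I_m -> nat)
    (A : forall j, 'M[R]_(k j, n)) (b : forall j, 'rV[R]_(k j)) :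
    'rV[R]_n -> 'rV[R]_m :=
  fun x => \row_(j < m) maxout_unit (A j) (b j) x.

Definition layers (R : realType) (n m : nat) (k : 'I_m -> nat) :
    set ('rV[R]_n -> 'rV[R]_m) :=
  [set f | exists (A : forall j, 'M[R]_(k j, n)) (b : forall j, 'rV[R]_(k j)),
     f = maxout_layer A b].

Definition layers_nobias (R : realType) (n m : nat) (k : 'I_m -> nat) :
    set ('rV[R]_n -> 'rV[R]_m) :=
  [set f | exists A : forall j, 'M[R]_(k j, n),
     f = maxout_layer A (fun j => 0 : 'rV[R]_(k j))].

(* [jacobian f] is total, with arbitrary values where f is not differentiable,
   so its continuity at x is only meaningful if f is differentiable around x. *)
Definition nonlinear_locus (R : realType) (n m : nat)
    (f : 'rV[R]_n -> 'rV[R]_m) : set 'rV[R]_n :=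
  [set x | ~ ((\forall y \near x, differentiable f y) /\
              {for x, continuous (jacobian f)})].

Definition linear_regions (R : realType) (n m : nat)
    (f : 'rV[R]_n -> 'rV[R]_m) : set (set 'rV[R]_n) :=
  [set connected_component (~` nonlinear_locus f) x
     | x in ~` nonlinear_locus f].

Definition has_num_regions (R : realType) (n m : nat)
    (f : 'rV[R]_n -> 'rV[R]_m) (N : nat) : Prop :=
  (linear_regions f #= `I_N)%card.

(* N(F) = N: every f in F has finitely many regions, at most N, and N is
   attained. *)
Definition max_num_regions (R : realType) (n m : nat)
    (F : set ('rV[R]_n -> 'rV[R]_m)) (N : nat) : Prop :=
  (exists2 f, F f & has_num_regions f N) /\
  (forall f, F f -> exists2 p : nat, has_num_regions f p & (p <= N)%N).

(* Binomial coefficient with integer upper index, equal to 0 when that index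
   is negative; needed for the value 0 of C(-1, 0). *)
Definition binz (a : int) (b : nat) : nat :=
  if a is Posz a' then 'C(a', b) else 0%N.

(* Main.v *)
(** Assign to a point the tuple of the indices of the active affine forms of the
units. The regions are then in bijection with the realizable tuples, and those
are counted as follows.

Upper bounds. For each unit the cells of its forms are pairwise disjoint convex
sets. If a weight on realizable tuples with values in [F_2] has vanishing
marginals on all sets of [s] units, then its marginals on sets of [s + 1] units are
simplicial cycles of dimension [s] in nerves of convex sets. Such a nerve in [R^n]
has no homology in dimensions at least [n] (Mayer-Vietoris while sweeping by a
hyperplane), hence the weight is determined by its marginals on at most [n] units, i.e. by as many bits as there
are vectors [a] with [0 <= a_i < k_i] and at most [n] nonzero entries. Without
biases the cells are cones; for cones in [R^n] that avoid the origin the homology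
in dimension [n - 1] is at most one dimensional (Mayer-Vietoris for the two sides
of a hyperplane); this costs one more bit for each set of [n] units, with forms not
all equal, that contains a fixed such unit.

Lower bounds. Identify inputs with polynomials [P] of bounded degree and let
the unit [i] see only [P(i)] and the leading coefficient, so that its breakpoints
are parallel hyperplanes close to [P(i) = i^n]. A vector [a] as above is realized
by a polynomial that vanishes approximately at the [i] with [a_i <> 0]; between
these nodes the sign of [P(i)] alternates, whence the reflection
[a_i |-> k_i - 1 - a_i] in [flip]. *)

Require Import Defs.
From HB Require Import structures.
From mathcomp Require Import all_boot all_order all_algebra.
From mathcomp Require Import boolp reals ring lra zify.

Set Implicit Arguments.
Unset Strict Implicit.
Unset Printing Implicit Defensive.

Import Order.TTheory GRing.Theory Num.Theory.

Local Open Scope ring_scope.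

(** * Simplicial chains over F_2 *)

Lemma F2_addrr (x : 'F_2) : x + x = 0.
Proof. by apply/val_inj; case: x => [[|[|]]]. Qed.

Lemma F2_oppr (x : 'F_2) : - x = x.
Proof. by apply/val_inj; case: x => [[|[|]]]. Qed.

Lemma F2_neq0 (x : 'F_2) : x != 0 -> x = 1.
Proof. by case: x => [[|[|]]] //= h _; apply/val_inj. Qed.

Section Chains.
Variable I : finType.
Implicit Types (P : {set I} -> Prop) (z y : {ffun {set I} -> 'F_2}) (s : {set I}).

(** No signs occur over [F_2]. The empty set counts as a simplex, so the homology is reduced. *)
Definition bd z : {ffun {set I} -> 'F_2} :=
  [ffun s : {set I} => \sum_(i | i \notin s) z (i |: s)].

(** Chains may be inhomogeneous: [q] bounds the number of vertices from below, so level [q] concerns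
    dimensions [q - 1] and above. *)
Definition chain_on P q z := forall s, z s != 0 -> P s /\ (q <= #|s|)%N.

Definition bounds P q z := exists2 y, chain_on P q.+1 y & bd y = z.

Definition acyclic P q := forall z, chain_on P q z -> bd z = 0 -> bounds P q z.

(** Over [F_2] this says that the reduced homology at level [q] is at most one dimensional. *)
Definition one_class P q := forall z z', chain_on P q z -> chain_on P q z' ->
  bd z = 0 -> bd z' = 0 -> [\/ bounds P q z, bounds P q z' | bounds P q (z + z')].

Definition down_closed P := forall i s, P (i |: s) -> P s.

Lemma bdD z y : bd (z + y) = bd z + bd y.
Proof.
apply/ffunP => s; rewrite !ffunE -big_split /=.
by apply: eq_bigr => i _; rewrite !ffunE.
Qed.

Lemma bd_bd z : bd (bd z) = 0.
Proof.
apply/ffunP => s; rewrite !ffunE.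
pose g i j := z (j |: (i |: s)).
(* The two new vertices are sorted by rank; exchanging them matches the two halves, which cancel
   modulo 2. *)
pose lt (i j : I) := (enum_rank i < enum_rank j)%N.
pose T (r : rel I) := \sum_(i | i \notin s) \sum_(j | (j \notin s) && r i j) g i j.
have -> : \sum_(i | i \notin s) bd z (i |: s) = T lt + T (fun i j => lt j i).
  rewrite -big_split; apply: eq_bigr => i his; rewrite ffunE.
  rewrite (bigID (lt i)) /=; congr (_ + _); apply: eq_bigl => j;
    rewrite !inE negb_or -andbA andbCA; congr (_ && _); rewrite /lt -?leqNgt.
    by have [->|] := eqVneq j i; rewrite ?ltnn.
  by rewrite [RHS]ltn_neqAle (inj_eq val_inj) (inj_eq enum_rank_inj).
suff -> : T (fun i j => lt j i) = T lt by rewrite F2_addrr.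
rewrite /T (exchange_big_dep (fun j => j \notin s)) /=; last by move=> i j _ /andP[].
apply: eq_bigr => i his; apply: eq_big => [j|j _]; last by rewrite /g setUCA.
by rewrite his.
Qed.

Lemma bd0 : bd 0 = 0.
Proof. by apply/ffunP => s; rewrite !ffunE big1 // => i _; rewrite ffunE. Qed.

Lemma chain_ffun_addrr z : z + z = 0.
Proof. by apply/ffunP => s; rewrite !ffunE F2_addrr. Qed.

Lemma chain_on0 P q : chain_on P q 0.
Proof. by move=> s; rewrite ffunE eqxx. Qed.

Lemma chain_onD P q z y : chain_on P q z -> chain_on P q y -> chain_on P q (z + y).
Proof.
move=> hz hy s; rewrite ffunE; have [->|/hz//] := eqVneq (z s) 0.
by rewrite add0r => /hy.
Qed.

Lemma chain_onW P Q q z : (forall s, P s -> Q s) -> chain_on P q z -> chain_on Q q z.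
Proof. by move=> PQ hz s /hz [/PQ]. Qed.

Lemma acyclicW P Q q : (forall s, P s <-> Q s) -> acyclic P q -> acyclic Q q.
Proof.
move=> PQ hP z hz z0; have [|y hy yz] := hP z _ z0.
  by apply: chain_onW hz => s /PQ.
by exists y => //; apply: chain_onW hy => s /PQ.
Qed.

Lemma one_classW P Q q : (forall s, P s <-> Q s) -> one_class P q -> one_class Q q.
Proof.
move=> PQ hP; have bW z : bounds P q z -> bounds Q q z.
  by move=> [y hy <-]; exists y => //; apply: chain_onW hy => s /PQ.
move=> z z' hz hz' z0 z0'.
have W y : chain_on Q q y -> chain_on P q y by apply: chain_onW => s /PQ.
have [/bW|/bW|/bW] := hP z z' (W _ hz) (W _ hz') z0 z0'.
- by constructor 1.
- by constructor 2.
- by constructor 3.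
Qed.

(** The cone with apex [v] over a cycle has that cycle as boundary; at a simplex through [v] this is
    the cycle condition at the opposite face [s :\ v]. *)
Lemma cone_acyclic P q v : (forall s, P s -> P (v |: s)) -> acyclic P q.
Proof.
move=> Pv z hz z0.
exists [ffun s : {set I} => if v \in s then z (s :\ v) else 0].
  move=> s; rewrite ffunE; case: ifPn => [vs /hz [/Pv]|]; last by rewrite eqxx.
  by rewrite setD1K // => Ps qs; split => //; rewrite (cardsD1 v s) vs.
apply/ffunP => s; rewrite ffunE; have [vs|vs] := boolP (v \in s).
  have : bd z (s :\ v) = 0 by rewrite z0 ffunE.
  rewrite ffunE (bigD1 v) /=; last by rewrite !inE eqxx.
  rewrite setD1K // => /eqP; rewrite addr_eq0 F2_oppr => /eqP ->.
  apply: eq_big => [i|i hi].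
    rewrite !inE; have [->|] := eqVneq i v; last by rewrite /= andbT.
    by rewrite vs.
  rewrite ffunE !inE vs orbT; congr (z _); apply/setP => j; rewrite !inE.
  have [->|jv] := eqVneq j v; last by [].
  by case: eqP hi => // <-; rewrite vs.
rewrite (bigD1 v) //= ffunE setU11 big1 ?addr0 => [|i /andP[hi iv]].
  by rewrite setU1K.
by rewrite ffunE !inE (negbTE vs) orbF eq_sym (negbTE iv).
Qed.

(** The connecting map of Mayer-Vietoris. The part of [z] in [P1] is split from the rest; as [z] is
    a cycle, both parts have the same boundary modulo 2, which lies in both subcomplexes. *)
Lemma MV_step P P1 P2 P0 q z : down_closed P1 -> down_closed P2 ->
  (forall s, P s -> P1 s \/ P2 s) -> (forall s, P1 s -> P2 s -> P0 s) ->
  chain_on P q.+1 z -> bd z = 0 ->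
  exists z1 z2, [/\ z = z1 + z2, chain_on P1 q.+1 z1, chain_on P2 q.+1 z2,
    bd z1 = bd z2 & chain_on P0 q (bd z1)].
Proof.
move=> d1 d2 PU PI hz z0.
pose z1 : {ffun {set I} -> 'F_2} := [ffun s => if `[< P1 s >] then z s else 0].
pose z2 : {ffun {set I} -> 'F_2} := [ffun s => if `[< P1 s >] then 0 else z s].
have zE : z = z1 + z2.
  by apply/ffunP => s; rewrite !ffunE; case: ifP => _; rewrite ?addr0 ?add0r.
have h1 : chain_on P1 q.+1 z1.
  by move=> s; rewrite ffunE; case: asboolP => [? /hz[]|]; rewrite ?eqxx.
have h2 : chain_on P2 q.+1 z2.
  move=> s; rewrite ffunE; case: asboolP => [|nP1 /hz[/PU[]//]]; by rewrite ?eqxx.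
have b12 : bd z1 = bd z2.
  apply/eqP; rewrite -subr_eq0; apply/eqP.
  rewrite -z0 zE bdD; congr (_ + _); apply/ffunP => s; rewrite ffunE.
  by rewrite F2_oppr.
have bdP Q z' : down_closed Q -> chain_on Q q.+1 z' -> chain_on Q q (bd z').
  move=> dQ hz' s; rewrite ffunE => nz.
  have [i hi zi] : exists2 i, i \notin s & z' (i |: s) != 0.
    apply: contrapT => nex; move/eqP: nz; apply; apply: big1 => i hi.
    by apply: contrapT => /eqP zi; apply: nex; exists i.
  by have [/dQ Qs] := hz' _ zi; rewrite cardsU1 hi ltnS.
exists z1, z2; split=> // s nz.
have [P1s qs] := bdP _ _ d1 h1 s nz; split=> //.
by move: nz; rewrite b12 => /(bdP _ _ d2 h2)[P2s _]; apply: PI.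
Qed.

(** A filling [y] of the common boundary in the intersection closes up both parts, and each
    resulting cycle is filled in its own piece. *)
Lemma MV_acyclic P P1 P2 P0 q : down_closed P1 -> down_closed P2 ->
  (forall s, P s -> P1 s \/ P2 s) -> (forall s, P1 s -> P2 s -> P0 s) ->
  (forall s, P1 s -> P s) -> (forall s, P2 s -> P s) ->
  (forall s, P0 s -> P1 s) -> (forall s, P0 s -> P2 s) ->
  acyclic P0 q -> acyclic P1 q.+1 -> acyclic P2 q.+1 -> acyclic P q.+1.
Proof.
move=> d1 d2 PU PI P1P P2P P01 P02 a0 a1 a2 z hz z0.
have [z1 [z2 [zE h1 h2 b12 hb]]] := MV_step d1 d2 PU PI hz z0.
have bb z' : chain_on P q.+1 z' -> bd (bd z') = 0.
  move=> _; exact: bd_bd.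
have [y hy yz] := a0 _ hb (bd_bd _).
have [|y1 hy1 yE1] := a1 (z1 + y) (chain_onD h1 (chain_onW P01 hy)).
  by rewrite bdD yz chain_ffun_addrr.
have [|y2 hy2 yE2] := a2 (z2 + y) (chain_onD h2 (chain_onW P02 hy)).
  by rewrite bdD yz b12 chain_ffun_addrr.
exists (y1 + y2); first exact: chain_onD (chain_onW P1P hy1) (chain_onW P2P hy2).
by rewrite bdD yE1 yE2 addrACA chain_ffun_addrr addr0 -zE.
Qed.

(** As both pieces are acyclic, a cycle bounds as soon as its connecting image does, so the
    alternative for two images lifts to the cycles. *)
Lemma MV_class P P1 P2 P0 q : down_closed P1 -> down_closed P2 ->
  (forall s, P s -> P1 s \/ P2 s) -> (forall s, P1 s -> P2 s -> P0 s) ->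
  (forall s, P1 s -> P s) -> (forall s, P2 s -> P s) ->
  (forall s, P0 s -> P1 s) -> (forall s, P0 s -> P2 s) ->
  acyclic P1 q.+1 -> acyclic P2 q.+1 -> one_class P0 q -> one_class P q.+1.
Proof.
move=> d1 d2 PU PI P1P P2P P01 P02 a1 a2 o0.
have key z z1 z2 y : z = z1 + z2 -> chain_on P1 q.+1 z1 -> chain_on P2 q.+1 z2 ->
    bd z1 = bd z2 -> chain_on P0 q.+1 y -> bd y = bd z1 -> bounds P q.+1 z.
  move=> zE h1 h2 b12 hy yz.
  have [|y1 hy1 yE1] := a1 (z1 + y) (chain_onD h1 (chain_onW P01 hy)).
    by rewrite bdD yz chain_ffun_addrr.
  have [|y2 hy2 yE2] := a2 (z2 + y) (chain_onD h2 (chain_onW P02 hy)).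
    by rewrite bdD yz b12 chain_ffun_addrr.
  exists (y1 + y2); first exact: chain_onD (chain_onW P1P hy1) (chain_onW P2P hy2).
  by rewrite bdD yE1 yE2 addrACA chain_ffun_addrr addr0 -zE.
move=> z z' hz hz' z0 z0'.
have [z1 [z2 [zE h1 h2 b12 hb]]] := MV_step d1 d2 PU PI hz z0.
have [z1' [z2' [zE' h1' h2' b12' hb']]] := MV_step d1 d2 PU PI hz' z0'.
have [[y hy yz]|[y hy yz]|[y hy yz]] := o0 _ _ hb hb' (bd_bd _) (bd_bd _).
- by constructor 1; apply: (key _ _ _ _ zE h1 h2 b12 hy yz).
- by constructor 2; apply: (key _ _ _ _ zE' h1' h2' b12' hy yz).
constructor 3; apply: (key _ (z1 + z1') (z2 + z2') y) => //.
- by rewrite zE zE' addrACA.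
- exact: chain_onD.
- exact: chain_onD.
- by rewrite !bdD b12 b12'.
- by rewrite bdD.
Qed.
End Chains.

(** * Weights on tuples and their marginals *)

(** Evaluation on [P] is linear with trivial kernel, hence injective, from the [2 ^ #|D|] weights
    supported on [D] to a space of [2 ^ #|P|] elements. *)
Lemma card_le_kernel (T B : finType) (D : {set T}) (P : {set B})
    (ev : {ffun T -> 'F_2} -> B -> 'F_2) :
  (forall (w w' : {ffun T -> 'F_2}) b, ev (w - w') b = ev w b - ev w' b) ->
  (forall w : {ffun T -> 'F_2}, (forall c, w c != 0 -> c \in D) ->
     (forall b, b \in P -> ev w b = 0) -> w = 0) ->
  (#|D| <= #|P|)%N.
Proof.
move=> evB ker.
pose W := [set w : {ffun T -> 'F_2} | w \in pffun_on 0 (mem D) predT].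
pose E := [set g : {ffun B -> 'F_2} | g \in pffun_on 0 (mem P) predT].
pose Phi (w : {ffun T -> 'F_2}) : {ffun B -> 'F_2} := [ffun b => if b \in P then ev w b else 0].
have WP (w : {ffun T -> 'F_2}) c : w \in W -> w c != 0 -> c \in D.
  by rewrite inE => /pffun_onP[/subsetP + _]; apply.
have : (#|Phi @: W| <= #|E|)%N.
  apply/subset_leq_card/subsetP => _ /imsetP[w _ ->]; rewrite inE.
  apply/pffun_onP; split=> [|//]; apply/subsetP => b; rewrite inE ffunE.
  by case: ifP => //; rewrite eqxx.
rewrite card_in_imset => [|w w' hw hw' /ffunP Ph].
  rewrite !cardsE !card_pffun_on (_ : #|predT| = 2%N); last exact: card_Fp.
  by rewrite leq_exp2l.
apply/eqP; rewrite -subr_eq0; apply/eqP; apply: ker => [c|b bP].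
  rewrite !ffunE; have [w0|/(WP _ _ hw)//] := eqVneq (w c) 0.
  by rewrite w0 sub0r oppr_eq0 => /(WP _ _ hw').
by have := Ph b; rewrite !ffunE bP evB => ->; rewrite subrr.
Qed.

Section Tuples.
Variables (m K : nat).
Notation tup := {ffun 'I_m -> 'I_K.+1}.
Notation idx := ('I_m * 'I_K.+1)%type.
Implicit Types (w : {ffun tup -> 'F_2}) (S : {set 'I_m}) (a c : tup).

(** Vertices are pairs of a unit and a label, so that a partial tuple becomes a simplex with one
    vertex per unit of [S]. *)
Definition face S c : {set idx} := [set (i, c i) | i in S].

Definition agree S c a := [forall i in S, c i == a i].

Definition marg w S a : 'F_2 := \sum_(c | agree S c a) w c.

Definition mchain w S : {ffun {set idx} -> 'F_2} :=
  [ffun s : {set idx} => \sum_(c | face S c == s) w c].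

Lemma mem_face S c x : (x \in face S c) = (x.1 \in S) && (x.2 == c x.1).
Proof.
apply/imsetP/andP => [[i iS ->]//|[xS /eqP x2]].
by exists x.1 => //; rewrite -x2 -surjective_pairing.
Qed.

Lemma card_face S c : #|face S c| = #|S|.
Proof. by rewrite card_imset // => i j []. Qed.

Lemma face_eq S c a : (face S c == face S a) = agree S c a.
Proof.
apply/eqP/forall_inP => [e i iS|h].
  have : (i, c i) \in face S a by rewrite -e mem_face /= iS eqxx.
  by rewrite mem_face /= iS.
apply/setP => x; rewrite !mem_face; case: (boolP (x.1 \in S)) => //= xS.
by rewrite (eqP (h _ xS)).
Qed.

Lemma mchain_face w S a : mchain w S (face S a) = marg w S a.
Proof. by rewrite ffunE; apply: eq_bigl => c; rewrite face_eq. Qed.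

Lemma mchain_neq0 w S s : mchain w S s != 0 -> exists2 c, face S c = s & w c != 0.
Proof.
rewrite ffunE => nz; apply: contrapT => h; case/eqP: nz; apply: big1 => c /eqP cs.
by apply: contrapT => /eqP ?; apply: h; exists c.
Qed.

Lemma mchain0P w S : (forall a, marg w S a = 0) <-> mchain w S = 0.
Proof.
split=> [h|h a]; last by rewrite -mchain_face h ffunE.
apply/ffunP => s; rewrite [RHS]ffunE; apply: contrapT => /eqP nz.
have [c cs _] := mchain_neq0 nz.
by move: nz; rewrite -cs mchain_face h eqxx.
Qed.

Lemma margB w w' S a : marg (w - w') S a = marg w S a - marg w' S a.
Proof.
by rewrite /marg -sumrB; apply: eq_bigr => c _; rewrite !ffunE.
Qed.

(** Deleting the vertex of unit [i] from a face forgets the coordinate [i], which is summation over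
    the labels of that unit. *)
Lemma bd_mchain w S : bd (mchain w S) = \sum_(i in S) mchain w (S :\ i).
Proof.
apply/ffunP => s; rewrite sum_ffunE ffunE.
under eq_bigr do rewrite ffunE.
rewrite (exchange_big_dep predT) //=.
under [RHS]eq_bigr do rewrite ffunE.
rewrite [RHS](exchange_big_dep predT) //=; apply: eq_bigr => c _.
(* For a fixed tuple [c], only a vertex [(i, c i)] can complete [s] to a face of [c]. *)
rewrite (reindex_onto (fun i => (i, c i)) fst) /=; last first.
  move=> x /andP[_ /eqP e]; have : x \in face S c by rewrite e !inE eqxx.
  by rewrite mem_face => /andP[_ /eqP <-]; rewrite -surjective_pairing.
apply: eq_bigl => i; rewrite eqxx andbT; apply/andP/andP => [[iNs /eqP e]|[iS /eqP e]].
  have iS : i \in S.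
    have : (i, c i) \in face S c by rewrite e !inE eqxx.
    by rewrite mem_face => /andP[].
  split=> //; apply/eqP/setP => x; rewrite mem_face !inE -andbA -(mem_face S) e !inE.
  have [->|xi] /= := eqVneq x (i, c i); first by rewrite /= eqxx /= (negbTE iNs).
  have [x1|//] := eqVneq x.1 i; rewrite /=.
  apply/esym/negbTE; apply: contraNN xi => xs.
  have : x \in face S c by rewrite e !inE xs orbT.
  by rewrite mem_face x1 => /andP[_ /eqP x2]; rewrite (surjective_pairing x) x1 x2.
rewrite -e mem_face !inE eqxx /=; split=> //; apply/eqP/setP => x.
rewrite !inE !mem_face !inE; have [->|xi] /= := eqVneq x (i, c i); first by rewrite iS eqxx.
have [x1|//] := eqVneq x.1 i; rewrite /=.
apply/negbTE; apply: contraNN xi => /andP[_ /eqP x2].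
by rewrite (surjective_pairing x) x2 x1.
Qed.

Section Families.
Variables (V : Type) (C : 'I_m -> 'I_K.+1 -> V -> Prop) (S : {set 'I_m}).
Hypothesis disj : forall i r r' x, C i r x -> C i r' x -> r = r'.

Definition fam (x : idx) : V -> Prop := fun v => x.1 \in S /\ C x.1 x.2 v.

Definition fnerve (s : {set idx}) := exists v, forall x, x \in s -> fam x v.

(** A point lies in at most one cell per unit, so a simplex of the nerve has at most one vertex for
    each unit. *)
Lemma fnerve_card s : fnerve s -> (#|s| <= #|S|)%N.
Proof.
move=> [v hv]; rewrite -(@card_in_imset _ _ fst s).
  by apply/subset_leq_card/subsetP => _ /imsetP[x /hv[xS _] ->].
move=> x y /hv[_ hx] /hv[_ hy] e.
rewrite (surjective_pairing x) (surjective_pairing y) e; congr pair.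
by apply: disj hx _; rewrite e.
Qed.

(** There are no simplices with more than [#|S|] vertices to bound with. Thus acyclicity at this
    level forces cycles to vanish. *)
Lemma bounds_eq0 z : bounds fnerve #|S| z -> z = 0.
Proof.
move=> [y hy <-]; rewrite (_ : y = 0) ?bd0 //.
apply/ffunP => s; rewrite ffunE; apply: contrapT => /eqP /hy[/fnerve_card].
by rewrite leqNgt => /negP.
Qed.

Definition realized w := forall c, w c != 0 -> exists v, forall i, i \in S -> C i (c i) v.

Lemma mchain_on w : realized w -> chain_on fnerve #|S| (mchain w S).
Proof.
move=> rw s /mchain_neq0[c <- /rw[v hv]]; rewrite card_face; split=> //.
by exists v => x; rewrite mem_face => /andP[xS /eqP x2]; split; rewrite // x2; exact: hv.
Qed.

Lemma mchain_cycle w : (forall i, i \in S -> mchain w (S :\ i) = 0) -> bd (mchain w S) = 0.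
Proof. by move=> h; rewrite bd_mchain big1. Qed.

Lemma acyclic_mchain w : acyclic fnerve #|S| -> realized w ->
  (forall i, i \in S -> mchain w (S :\ i) = 0) -> mchain w S = 0.
Proof.
by move=> ac rw h; apply/bounds_eq0/ac; [exact: mchain_on|exact: mchain_cycle].
Qed.

Lemma one_class_mchain w w' : one_class fnerve #|S| -> realized w -> realized w' ->
  (forall i, i \in S -> mchain w (S :\ i) = 0) ->
  (forall i, i \in S -> mchain w' (S :\ i) = 0) ->
  [\/ mchain w S = 0, mchain w' S = 0 | mchain w S = mchain w' S].
Proof.
move=> oc rw rw' h h'.
have [/bounds_eq0|/bounds_eq0|/bounds_eq0 e] := oc _ _ (mchain_on rw) (mchain_on rw')
  (mchain_cycle h) (mchain_cycle h').
- by constructor 1.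
- by constructor 2.
constructor 3; rewrite -[LHS]addr0 -(chain_ffun_addrr (mchain w' S)) addrA e.
by rewrite add0r.
Qed.

End Families.

Definition upd a i r : tup := [ffun j => if j == i then r else a j].

Definition supp a := [set i | a i != ord0].

Lemma marg_split w S a i : i \in S ->
  marg w (S :\ i) a = \sum_r marg w S (upd a i r).
Proof.
move=> iS; rewrite /marg (partition_big (fun c : tup => c i) predT) //=.
apply: eq_bigr => r _; apply: eq_bigl => c; apply/andP/forall_inP.
  move=> [/forall_inP h /eqP ci] j jS; rewrite ffunE; case: (eqVneq j i) => [->|ji].
    exact/eqP.
  by apply: h; rewrite !inE ji.
move=> h; split; last by have := h i iS; rewrite ffunE eqxx.
apply/forall_inP => j; rewrite !inE => /andP[ji jS].
by have := h j jS; rewrite ffunE (negbTE ji).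
Qed.

Lemma marg_agree w S a a' : agree S a a' -> marg w S a = marg w S a'.
Proof.
move=> /forall_inP h; apply: eq_bigl => c; apply/forall_inP/forall_inP => hc i iS.
  by rewrite (eqP (hc i iS)) h.
by rewrite (eqP (hc i iS)) eq_sym h.
Qed.

Variable k : 'I_m -> nat.

Definition box_le (j : nat) := [set a : tup | [forall i, a i < k i]%N & (#|supp a| <= j)%N].

(** The marginal at a zero entry is a marginal on fewer units minus those at the nonzero labels of
    that unit. Induction on the number of zero entries leaves the tuples without zeros on [S], which
    are tested by assumption. *)
Lemma marg_eq0 w j : (forall i, 0 < k i)%N -> (forall c, w c != 0 -> forall i, (c i < k i)%N) ->
  (forall a, a \in box_le j -> marg w (supp a) a = 0) ->
  forall S, (#|S| <= j)%N -> mchain w S = 0.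
Proof.
move=> k0 wk red S Sj; apply/mchain0P => a.
have [N] := ubnP #|[set i in S | a i == ord0]|.
elim: N => // N IH in S a Sj *; rewrite ltnS => hN.
have [z0|[i]] := set_0Vmem [set i in S | a i == ord0]; last first.
  rewrite inE => /andP[iS /eqP ai].
  have lt (S' : {set 'I_m}) a' :
      {subset [set j in S' | a' j == ord0] <= [set j in S | a j == ord0] :\ i} ->
      (#|[set j in S' | a' j == ord0]| < N)%N.
    move=> /subsetP/subset_leq_card h; apply: leq_ltn_trans h _.
    by rewrite (leq_trans _ hN) // [ltnRHS](cardsD1 i) inE iS ai eqxx.
  have := marg_split w a iS; rewrite (bigD1 ord0) //= [X in _ + X]big1 ?addr0.
    rewrite (@marg_agree w S (upd a i ord0) a) => [<-|].
      apply: IH; first by apply: leq_trans Sj; apply: subset_leq_card; exact: subD1set.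
      by apply: lt => l; rewrite !inE => /andP[/andP[-> ->] ->].
    apply/forall_inP => l lS; rewrite ffunE; case: (eqVneq l i) => // ->.
    by rewrite ai.
  move=> r r0; apply: IH => //; apply: lt => l; rewrite !inE ffunE.
  by case: (eqVneq l i) => [->|_ /andP[-> ->]//]; rewrite (negbTE r0) andbF.
(* A label beyond the rank occurs in no tuple on which [w] is nonzero. *)
have [ka|nka] := boolP [forall i in S, (a i < k i)%N]; last first.
  apply: big1 => c /forall_inP ca; apply: contrapT => /eqP wc.
  case/negP: nka; apply/forall_inP => i iS; rewrite -(eqP (ca i iS)).
  exact: wk.
pose a' : tup := [ffun i => if i \in S then a i else ord0].
have a'S : agree S a' a by apply/forall_inP => i iS; rewrite ffunE iS.
have sa' : supp a' = S.
  apply/setP => i; rewrite inE ffunE; case: ifP => iS; last by rewrite eqxx.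
  by apply/negP => ai; move/setP/(_ i): z0; rewrite !inE iS ai.
rewrite -(marg_agree w a'S) -{1}sa'; apply: red; rewrite inE sa' Sj andbT.
apply/forallP => i; rewrite ffunE; case: ifP => iS; first exact: (forall_inP ka).
exact: k0.
Qed.

Lemma card_supp S : (forall i, 0 < k i <= K.+1)%N ->
  #|[set a : tup | [forall i, a i < k i]%N & supp a == S]| = (\prod_(i in S) (k i - 1))%N.
Proof.
move=> kK.
pose F i := if i \in S then [pred r : 'I_K.+1 | (r < k i)%N & r != ord0] else pred1 ord0.
have -> : [set a : tup | [forall i, a i < k i]%N & supp a == S] = [set a in family F].
  apply/setP => a; rewrite !inE; apply/andP/familyP => [[/forallP ka /eqP sa] i|h].
    by rewrite /F -sa inE; case: ifPn => [ai|/negPn ai]; rewrite !inE ?ka.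
  split.
    apply/forallP => i; have := h i; rewrite /F; case: ifP => _; rewrite inE => /=.
      by case/andP.
    by move/eqP => ->; case/andP: (kK i).
  apply/eqP/setP => i; have := h i; rewrite /F inE; case: ifP => _; rewrite !inE.
    by case/andP.
  by move->.
rewrite cardsE card_family foldrE big_map big_enum /= [RHS]big_mkcond /=.
apply: eq_bigr => i _; rewrite /F; case: ifP => _; last by rewrite card1.
have /andP[k0 kiK] := kK i.
have -> : #|[pred r : 'I_K.+1 | (r < k i)%N & r != ord0]| =
          #|[set r : 'I_K.+1 | (r < k i)%N] :\ ord0|.
  by rewrite -cardsE; apply: eq_card => r; rewrite !inE andbC.
have E : #|[set r : 'I_K.+1 | (r < k i)%N]| = k i.
  rewrite -[RHS]card_ord -(@card_imset _ _ (widen_ord kiK)) => [|x y /(congr1 val) /= /val_inj//].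
  apply: eq_card => r; rewrite inE; apply/idP/imsetP => [rk|[x _ ->]]; last exact: (ltn_ord x).
  by exists (Ordinal rk) => //; apply: val_inj.
by rewrite -[in RHS]E [in RHS](cardsD1 ord0) inE k0 addKn.
Qed.

Lemma card_box_le j : (forall i, 0 < k i <= K.+1)%N ->
  #|box_le j| = (\sum_(0 <= l < j.+1) \sum_(S : {set 'I_m} | #|S| == l)
                   \prod_(i in S) (k i - 1))%N.
Proof.
move=> kK.
have -> : #|box_le j| = (\sum_(S : {set 'I_m} | (#|S| <= j)%N) \prod_(i in S) (k i - 1))%N.
  rewrite -sum1_card (partition_big supp (fun S => (#|S| <= j)%N)) /=; last first.
    by move=> a; rewrite inE => /andP[].
  apply: eq_bigr => S Sj; rewrite -card_supp // -sum1_card; apply: eq_bigl => a.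
  by rewrite !inE -andbA; case: eqVneq => [->|]; rewrite ?Sj ?andbF.
rewrite big_mkord (partition_big (fun S : {set 'I_m} => inord #|S| : 'I_j.+1) predT) //=.
apply: eq_bigr => l _; apply: eq_bigl => S.
apply/andP/eqP => [[Sj /eqP <-]|e]; first by rewrite inordK.
have lj : (l < j.+1)%N := ltn_ord l.
by rewrite e -ltnS lj; split=> //; apply/eqP/val_inj; rewrite /= inordK.
Qed.

End Tuples.

(** * Tuples realized by polynomials *)

Section Flip.
Variables (m K : nat) (k : 'I_m -> nat).
Hypothesis kK : forall i, (0 < k i <= K.+1)%N.
Notation tup := {ffun 'I_m -> 'I_K.+1}.
Implicit Types (a : tup) (S T : {set 'I_m}).

Definition below S (i : 'I_m) := #|[set j in S | (j < i)%N]|.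
Definition above S (i : 'I_m) := #|[set j in S | (i < j)%N]|.

Lemma card_below_above S i : #|S| = (below S i + (i \in S) + above S i)%N.
Proof.
rewrite -(cardsID [set j : 'I_m | (j < i)%N]) -addnA; congr (_ + _)%N.
  by apply: eq_card => j; rewrite !inE.
rewrite (cardsD1 i) !inE ltnn /=; congr (_ + _)%N.
apply: eq_card => j; rewrite !inE -leqNgt.
have [->|ji] := eqVneq j i; first by rewrite ltnn andbF.
have -> : (i < j)%N = (i <= j)%N by rewrite ltn_neqAle eq_sym (inj_eq val_inj) ji.
by rewrite /= andbC.
Qed.

(** Off the support, odd parity will force the top label instead of 0. Reflecting the nonzero
    entries as well keeps them distinct from the top label, hence injectivity. *)
Definition flip d a : tup :=
  [ffun i => if odd (d + below (supp a) i) then inord (k i - 1 - a i) else a i].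

Lemma flip_val d a i : (a i < k i)%N ->
  flip d a i = (if odd (d + below (supp a) i) then k i - 1 - a i else a i)%N :> nat.
Proof.
move=> ak; rewrite ffunE; case: ifP => // _; rewrite inordK //.
by have := kK i; lia.
Qed.

(** Entries are recovered from left to right, since the parity at [i] depends only on the entries
    before [i]. *)
Lemma flip_inj d a a' : (forall i, a i < k i)%N -> (forall i, a' i < k i)%N ->
  flip d a = flip d a' -> a = a'.
Proof.
move=> ak ak' /ffunP e.
suff all N (i : 'I_m) : (i < N)%N -> a i = a' i by apply/ffunP => i; exact: (all m).
elim: N i => // N IH i; rewrite ltnS => iN.
have bE : below (supp a) i = below (supp a') i.
  apply: eq_card => j; rewrite !inE; case: (ltnP j i) => ji; rewrite ?andbF //.
  by rewrite IH // (leq_trans ji).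
have := congr1 (@nat_of_ord _) (e i); rewrite !flip_val // bE => h.
apply: val_inj => /=; move: h; case: ifP => // _.
by have := ak i; have := ak' i; lia.
Qed.

Definition top_tup T : tup := [ffun i => if i \in T then inord (k i - 1) else ord0].

Lemma top_tup_val T i : top_tup T i = (if i \in T then k i - 1 else 0)%N :> nat.
Proof. by rewrite ffunE; case: ifP => // _; rewrite inordK //; have := kK i; lia. Qed.

Lemma top_tup_lt T i : (top_tup T i < k i)%N.
Proof. by rewrite top_tup_val; have := kK i; case: ifP => _; lia. Qed.

Definition wide : {set 'I_m} := [set i | (1 < k i)%N].

Lemma supp_top_tup T : T \subset wide -> supp (top_tup T) = T.
Proof.
move=> /subsetP Tw; apply/setP => i; rewrite inE -(inj_eq val_inj) /= top_tup_val.
by case: ifP => // /Tw; rewrite inE /= => ?; apply/eqP; lia.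
Qed.

Definition tops d i0 : {set {set 'I_m}} :=
  [set T : {set 'I_m} | [&& T \subset wide, i0 \in T & #|T| == d.+1]].

Lemma card_tops d i0 : i0 \in wide -> #|tops d i0| = 'C(#|wide|.-1, d).
Proof.
move=> iw; have -> : #|wide|.-1 = #|wide :\ i0| by rewrite (cardsD1 i0 wide) iw.
rewrite -cards_draws -(@card_in_imset _ _ (fun T => T :\ i0) (tops d i0)); last first.
  move=> S T; rewrite !inE => /and3P[_ iS _] /and3P[_ iT _] e.
  by rewrite -(setD1K iS) -(setD1K iT) e.
apply: eq_card => U; apply/imsetP/idP => [[T + ->]|].
  rewrite !inE => /and3P[Tw iT /eqP Td]; rewrite setSD //=.
  by rewrite -eqSS -Td [in X in _ == X](cardsD1 i0) iT.
rewrite inE => /andP[Uw /eqP Ud].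
have iU : i0 \notin U by apply/negP => /(subsetP Uw); rewrite !inE eqxx.
exists (i0 |: U); last by rewrite setU1K.
rewrite inE setU11 cardsU1 iU Ud eqxx !andbT; apply/subsetP => j; rewrite !inE.
by move=> /orP[/eqP ->|/(subsetP Uw)]; rewrite ?inE; [move: iw; rewrite inE|case/andP].
Qed.

(** The two families are disjoint: tuples from [tops] have [d + 1] nonzero entries, those of the box
    at most [d]. *)
Lemma card_flips d (D : {set tup}) i0 : i0 \in wide ->
  (forall a, a \in box_le K k d -> flip d a \in D) ->
  (forall T, T \in tops d i0 -> flip d (top_tup T) \in D) ->
  ('C(#|wide|.-1, d) + #|box_le K k d| <= #|D|)%N.
Proof.
move=> iw hb ht.
have topD T : T \in tops d i0 -> supp (top_tup T) = T /\ #|T| = d.+1.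
  by rewrite inE => /and3P[Tw _ /eqP]; rewrite supp_top_tup.
have inj1 : {in tops d i0 &, injective top_tup}.
  by move=> S T /topD[sS _] /topD[sT _] e; rewrite -sS -sT e.
pose X := (top_tup @: tops d i0) :|: box_le K k d.
have XE : #|X| = ('C(#|wide|.-1, d) + #|box_le K k d|)%N.
  rewrite cardsU card_in_imset // card_tops // (_ : _ :&: _ = set0) ?cards0 ?subn0 //.
  apply/setP => a; rewrite !inE; apply/negbTE/negP => /andP[/imsetP[T Tt ->]].
  by have [-> ->] := topD T Tt; rewrite ltnn andbF.
have Xk a : a \in X -> forall i, (a i < k i)%N.
  rewrite in_setU => /orP[/imsetP[T _ ->] i|]; first exact: top_tup_lt.
  by rewrite inE => /andP[/forallP].
rewrite -XE -(@card_in_imset _ _ (flip d) X).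
  apply/subset_leq_card/subsetP => _ /imsetP[a + ->].
  by rewrite in_setU => /orP[/imsetP[T Tt ->]|]; [exact: ht|exact: hb].
by move=> a a' /Xk ak /Xk ak'; exact: flip_inj.
Qed.

Lemma card_flips0 d (D : {set tup}) :
  (forall a, a \in box_le K k d -> flip d a \in D) -> (#|box_le K k d| <= #|D|)%N.
Proof.
move=> hb; rewrite -(@card_in_imset _ _ (flip d) (box_le K k d)).
  by apply/subset_leq_card/subsetP => _ /imsetP[a /hb + ->].
move=> a a'; rewrite !inE => /andP[/forallP ak _] /andP[/forallP ak' _].
exact: flip_inj.
Qed.
End Flip.

(** * Signs and interpolation of real polynomials *)

Section Polynomials.
Variable R : realType.

Lemma prod_sign (x : R) (r : seq R) : x \notin r ->
  0 < (-1) ^+ count (fun z => x < z) r * (\prod_(z <- r) ('X - z%:P)).[x].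
Proof.
elim: r => [|z r IH]; first by rewrite big_nil hornerC expr0 mul1r ltr01.
rewrite inE negb_or => /andP[xz /IH pos]; rewrite big_cons hornerM hornerXsubC /=.
rewrite exprD mulrACA mulr_gt0 //; have [h|h|h] := ltrgtP x z.
- by rewrite expr1 mulN1r oppr_gt0 subr_lt0.
- by rewrite expr0 mul1r subr_gt0.
by rewrite h eqxx in xz.
Qed.

Lemma prod_sign_pos (x : R) (r : seq R) : x \notin r ->
  ~~ odd (count (fun z => x < z) r) -> 0 < (\prod_(z <- r) ('X - z%:P)).[x].
Proof. by move=> /prod_sign; rewrite -signr_odd => + /negbTE e; rewrite e mul1r. Qed.

Lemma prod_sign_neg (x : R) (r : seq R) : x \notin r ->
  odd (count (fun z => x < z) r) -> (\prod_(z <- r) ('X - z%:P)).[x] < 0.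
Proof. by move=> /prod_sign; rewrite -signr_odd => + e; rewrite e mulN1r oppr_gt0. Qed.

Lemma small_scale (T : finType) (f g : T -> R) : (forall t, 0 <= f t) -> (forall t, 0 < g t) ->
  exists2 e : R, 0 < e & forall t, e * f t < g t.
Proof.
move=> f0 g0; have fg t : 0 <= f t / g t by rewrite divr_ge0 // ltW.
have s0 : 0 < 1 + \sum_t f t / g t by rewrite ltr_pwDl ?sumr_ge0.
(* The sum dominates every ratio [f t / g t], and the summand 1 keeps it positive. *)
exists (1 + \sum_t f t / g t)^-1; first by rewrite invr_gt0.
move=> t; rewrite mulrC ltr_pdivrMr // -ltr_pdivrMl // mulrC.
by rewrite (bigD1 t) //= addrCA ltrDl ltr_pwDl // sumr_ge0.
Qed.

Section Interpolation.
Variables (J : finType) (x : J -> R) (S : {set J}) (v : J -> R).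
Hypothesis x_inj : injective x.

Definition interp : {poly R} := \sum_(i in S)
  (v i / \prod_(j in S :\ i) (x i - x j)) *: \prod_(z <- map x (enum (S :\ i))) ('X - z%:P).

Lemma interp_size : (size interp <= #|S|)%N.
Proof.
apply: leq_trans (size_sum _ _ _) _; apply/bigmax_leqP => i iS.
apply: leq_trans (size_scale_leq _ _) _.
by rewrite size_prod_XsubC size_map -cardE [leqRHS](cardsD1 i) iS.
Qed.

Lemma interpE i : i \in S -> interp.[x i] = v i.
Proof.
move=> iS; have pE l : (\prod_(z <- map x (enum (S :\ l))) ('X - z%:P)).[x i] =
    \prod_(j in S :\ l) (x i - x j).
  by rewrite big_map horner_prod big_enum /=; apply: eq_bigr => j _; rewrite hornerXsubC.
rewrite /interp horner_sum (bigD1 i) //= [X in _ + X]big1 ?addr0 => [|l /andP[lS li]].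
  rewrite hornerZ pE divfK //; apply/prodf_neq0 => j; rewrite !inE => /andP[ji _].
  by rewrite subr_eq0 (inj_eq x_inj) eq_sym.
rewrite hornerZ pE [X in _ * X](bigD1 i) /= ?subrr ?mul0r ?mulr0 //.
by rewrite !inE iS eq_sym li.
Qed.
End Interpolation.

End Polynomials.

(** * Polynomials with prescribed labels at the nodes *)

Section Realization.
Variables (R : realType) (m K : nat) (k : 'I_m -> nat) (d : nat).
Hypothesis kK : forall i, (0 < k i <= K.+1)%N.
Notation tup := {ffun 'I_m -> 'I_K.+1}.
Implicit Types (S T : {set 'I_m}) (i j : 'I_m) (a : tup).

Definition node (i : 'I_m) : R := (i : nat)%:R.

Lemma node_inj : injective node.
Proof. by move=> i j /eqP; rewrite eqr_nat => /eqP /val_inj. Qed.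

(* Sufficient conditions on [u] for [q] to be the only maximizer of
   [s * u - e * s * (s + 1) / 2], resp. [s * u + e * s * (s + 1) / 2], over [s < k]. *)
Definition label_up (e : R) (k q : nat) (u : R) :=
  [\/ u = e * (q%:R + 2^-1), q = 0%N /\ u <= 0 | q = k.-1 /\ e * k%:R < u].

Definition label_down (e : R) (k q : nat) (u : R) :=
  [\/ k = 1%N, q = k.-1 /\ 0 < u | q = 0%N /\ u < - (e * k%:R)].

(* The padding root [m] lies to the right of all nodes. *)
Definition roots_up (S : {set 'I_m}) : seq R :=
  map node (enum S) ++ nseq (d - #|S|) m%:R.

(** The shift by one half keeps the roots off the nodes; the sign changes just before each node of
    [T] other than [i0]. *)
Definition roots_down (T : {set 'I_m}) (i0 : 'I_m) : seq R :=
  map (fun j => node j - 2^-1) (enum (T :\ i0)).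

Lemma count_enum (S : {set 'I_m}) (P : pred 'I_m) : count P (enum S) = #|[set j in S | P j]|.
Proof.
rewrite -size_filter cardE; congr size; rewrite /enum_mem -filter_predI.
by apply: eq_filter => j; rewrite /= !inE andbC.
Qed.

(** The padding raises the number of roots to [d], of which exactly [below S i] lie to the left of
    the node. *)
Lemma count_roots_up S i : (#|S| <= d)%N -> i \notin S ->
  odd (count (fun z => node i < z) (roots_up S)) = odd (d + below S i).
Proof.
move=> Sd iS; rewrite count_cat count_map count_enum count_nseq.
rewrite (_ : node i < m%:R) ?mul1n; last by rewrite ltr_nat.
rewrite (_ : #|_| = above S i); last first.
  by apply: eq_card => j; rewrite !inE /= ltr_nat.
have := card_below_above S i; rewrite (negbTE iS) addn0 => e.
have -> : (d = above S i + (d - #|S|) + below S i)%N by lia.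
move: (d - #|S|)%N => c; rewrite e.
have -> : (above S i + c + below S i - (below S i + above S i) = c)%N by lia.
by rewrite !oddD; case: (odd (above S i)); case: (odd c); case: (odd (below S i)).
Qed.

Lemma notin_roots_up S i : i \notin S -> node i \notin roots_up S.
Proof.
move=> iS; rewrite mem_cat negb_or; apply/andP; split.
  by rewrite (mem_map node_inj) mem_enum.
by apply/negP => /nseqP[/eqP]; rewrite eqr_nat => /eqP im _; have := ltn_ord i; lia.
Qed.

Lemma lt_node_half (i j : 'I_m) : (node i < node j - 2^-1) = (i < j)%N.
Proof.
rewrite /node; apply/idP/idP => [h|].
  rewrite ltnNge; apply/negP => ji; move: h.
  by rewrite ltNge; have := ji; rewrite -(ler_nat R) => {}ji; rewrite (le_trans _ ji) //; lra.
rewrite -(ler_nat R) -natr1; lra.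
Qed.

Lemma notin_roots_down T i0 i : node i \notin roots_down T i0.
Proof.
apply/negP => /mapP[j _ e]; have := lt_node_half i j; rewrite -e ltxx => /esym/negbT.
rewrite -leqNgt -(ler_nat R) => h; move: e; rewrite /node; lra.
Qed.

Lemma count_roots_down T i0 i : i0 \in wide k -> (forall j, j \in wide k -> (i0 <= j)%N) ->
  T \in tops k d i0 -> i \in wide k ->
  odd (count (fun z => node i < z) (roots_down T i0)) = (odd (d + below T i) (+) (i \notin T)).
Proof.
move=> iw0 imin; rewrite inE => /and3P[Tw iT /eqP Td] iw.
rewrite count_map (eq_count (a2 := fun j : 'I_m => (i < j)%N)); last first.
  by move=> j; rewrite /= lt_node_half.
rewrite count_enum (_ : #|_| = above T i); last first.
  (* Omitting [i0] does not change the count, as no wide unit lies to the left of [i0]. *)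
  apply: eq_card => j; rewrite !inE; have [->|//] := eqVneq j i0.
  by rewrite /= ltnNge imin // andbF.
have := congr1 odd (card_below_above T i); rewrite Td oddS !oddD.
by case: (i \in T); case: (odd d); case: (odd (below T i)); case: (odd (above T i)).
Qed.

Definition gap S := \prod_(z <- roots_up S) ('X - z%:P) : {poly R}.
Definition gap_down T i0 := \prod_(z <- roots_down T i0) ('X - z%:P) : {poly R}.

Lemma coef_gap (r : seq R) : size r = d -> (\prod_(z <- r) ('X - z%:P) : {poly R})`_d = 1 /\
  (size (\prod_(z <- r) ('X - z%:P) : {poly R})%R <= d.+1)%N.
Proof.
move=> rd; have s : size (\prod_(z <- r) ('X - z%:P) : {poly R}) = d.+1.
  by rewrite size_prod_XsubC rd.
rewrite s; split=> //; have := monic_prod_XsubC r predT id.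
by rewrite monicE lead_coefE s => /eqP.
Qed.

(** Once scaled by [e], the value for label [q] lies midway between the breakpoints [e * q] and
    [e * (q + 1)] of that label. *)
Definition target (a : tup) : {poly R} :=
  interp node (supp a) (fun i => (flip k d a i : nat)%:R + 2^-1).

(** In the first family a small multiple of the interpolant sets the labels on the support, where
    [gap] vanishes; elsewhere the sign of [gap] selects an extreme label. In the second family the
    sign of [gap_down] selects an extreme label at every wide unit. *)
Theorem realize : exists2 e : R, 0 < e &
  (forall a, a \in box_le K k d -> exists P : {poly R},
     [/\ (size P <= d.+1)%N, P`_d = -1 &
      forall i, label_up e (k i) (flip k d a i) P.[node i]]) /\
  (forall i0 T, i0 \in wide k -> (forall j, j \in wide k -> (i0 <= j)%N) ->
     T \in tops k d i0 -> exists P : {poly R},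
     [/\ (size P <= d.+1)%N, P`_d = 1 &
      forall i, label_down e (k i) (flip k d (top_tup K k T) i) P.[node i]]).
Proof.
pose F (t : (tup * 'I_m) + ({set 'I_m} * 'I_m * 'I_m)) : R := match t with
  | inl (a, i) => `|(target a).[node i]| + (k i)%:R
  | inr (_, _, i) => (k i)%:R end.
(* One finite index type gathers all conditions on [e]. At a node of the support, where [gap]
   vanishes, [1 + F t] is a positive stand-in. *)
pose H (t : (tup * 'I_m) + ({set 'I_m} * 'I_m * 'I_m)) : R := match t with
  | inl (a, i) => if i \in supp a then 1 + F t else `|(gap (supp a)).[node i]|
  | inr (T, i0, i) => `|(gap_down T i0).[node i]| end.
have [||e e0 he] := @small_scale _ _ F H.
- by move=> [[a i]|[[T i0] i]] /=; rewrite ?addr_ge0.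
- have nz r x : x \notin r -> 0 < `|(\prod_(z <- r) ('X - z%:P)).[x] : R|.
    by rewrite normr_gt0 -root_prod_XsubC.
  move=> [[a i]|[[T i0] i]] /=; last exact/nz/notin_roots_down.
  by case: ifPn => [_|/notin_roots_up/nz//]; rewrite ltr_pwDl ?addr_ge0.
exists e => //; split=> [a ab|i0 T iw imin Tt].
  have /andP[/forallP ak Sd] : [forall i, a i < k i]%N && (#|supp a| <= d)%N.
    by move: ab; rewrite inE.
  have sr : size (roots_up (supp a)) = d.
    by rewrite size_cat size_map -cardE size_nseq subnKC.
  have [g1 gs] := coef_gap sr.
  have ts : (size (target a) <= d)%N by apply: leq_trans (interp_size _ _ _) Sd.
  (* The interpolant has size at most [d], so the coefficient -1 at [d] comes from [gap] alone. *)
  exists (e *: target a - gap (supp a)); split.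
  - apply: leq_trans (size_polyD _ _) _; rewrite geq_max size_polyN gs andbT.
    by apply: leq_trans (size_scale_leq _ _) (leqW ts).
  - by rewrite coefB coefZ g1 nth_default // mulr0 sub0r.
  move=> i; rewrite hornerD hornerN hornerZ.
  have [iS|iS] := boolP (i \in supp a).
    constructor 1; rewrite (interpE _ node_inj iS).
    have /rootP -> : root (gap (supp a)) (node i).
      by rewrite root_prod_XsubC mem_cat map_f // mem_enum.
    by rewrite subr0.
  have ai : a i = ord0 by apply/eqP; move: iS; rewrite inE negbK.
  have := he (inl (a, i)); rewrite /= (negbTE iS) mulrDr => bound.
  have tb : `|e * (target a).[node i]| = e * `|(target a).[node i]|.
    by rewrite normrM gtr0_norm.
  have ek : 0 <= e * (k i)%:R by rewrite mulr_ge0 // ltW.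
  rewrite /label_up flip_val // ai subn0 subn1 -count_roots_up //.
  case: ifPn => par.
    constructor 3; split=> //.
    have gneg := prod_sign_neg (notin_roots_up iS) par.
    move: bound; rewrite [X in _ < X]ltr0_norm // -tb => bound.
    have := ler_normr (- (e * (target a).[node i])) (e * (target a).[node i]).
    have := ler_norm (- (e * (target a).[node i])); rewrite normrN /gap; lra.
  constructor 2; split=> //.
  have gpos := prod_sign_pos (notin_roots_up iS) par.
  move: bound; rewrite [X in _ < X]gtr0_norm // -tb => bound.
  have := ler_norm (e * (target a).[node i]); rewrite /gap; lra.
have Td : #|T| = d.+1 by move: Tt; rewrite inE => /and3P[_ _ /eqP].
have iT : i0 \in T by move: Tt; rewrite inE => /and3P[].
have sr : size (roots_down T i0) = d.
  by rewrite size_map -cardE; apply/eqP; rewrite -eqSS -Td [in X in _ == X](cardsD1 i0) iT.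
have [g1 gs] := coef_gap sr.
exists (gap_down T i0); split=> // i.
have := kK i; case: (ltnP 1 (k i)) => [ik _|]; last by move=> *; constructor 1; lia.
have iwi : i \in wide k by rewrite inE.
have := count_roots_down iw imin Tt iwi => par.
have := he (inr (T, i0, i)); rewrite /= => bound.
rewrite /label_down flip_val ?top_tup_lt // top_tup_val // supp_top_tup //; last first.
  by move: Tt; rewrite inE => /and3P[].
have [odd_c|ev_c] := boolP (odd (count (fun z => node i < z) (roots_down T i0))).
  constructor 3; have gneg := prod_sign_neg (notin_roots_down T i0 i) odd_c.
  split; last by move: bound; rewrite ltr0_norm // ltrNr.
  by move: odd_c; rewrite par; case: (i \in T); case: (odd _) => //= _; lia.
constructor 2; have gpos := prod_sign_pos (notin_roots_down T i0 i) ev_c.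
split=> //.
by move: ev_c; rewrite par; case: (i \in T); case: (odd _) => //= _; lia.
Qed.
End Realization.

From mathcomp Require Import all_classical all_reals all_analysis.
Import numFieldNormedType.Exports.

Local Open Scope classical_set_scope.
Local Open Scope ring_scope.

(** * Nerves of convex sets *)

Lemma continuous_mx (R : realType) (T : topologicalType) m n (f : T -> 'M[R]_(m, n)) :
  (forall i j, continuous (fun x => f x i j)) -> continuous f.
Proof.
move=> cf x A [P Pn PA]; rewrite /nbhs /=.
have : nbhs x [set y | forall i j, P i j (f y i j)].
  apply: filter_forall => i; apply: filter_forall => j.
  by apply: (cf i j x); apply: Pn.
by apply: filterS => y Py; apply: PA.
Qed.

Lemma mulmxr_continuous (R : realType) m n p (B : 'M[R]_(n, p)) :
  continuous (fun A : 'M[R]_(m, n) => A *m B).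
Proof.
apply: continuous_mx => i j.
under eq_fun do rewrite mxE.
apply: (continuous_big add_continuous) => k _ x; apply: continuousM; first exact: coord_continuous.
exact: cst_continuous.
Qed.

Definition convex (R : realType) (V : lmodType R) (K : set V) :=
  forall x y (t : R), K x -> K y -> 0 <= t -> t <= 1 -> K ((1 - t) *: x + t *: y).

Definition nerve (I : finType) V (K : I -> set V) (s : {set I}) :=
  exists x, forall i, i \in s -> K i x.

Section Hull.
Variables (R : realType) (N d : nat) (X : 'M[R]_(N, d)).

Definition weights (A : pred 'I_N) : set 'rV[R]_N :=
  [set a | (forall j, 0 <= a 0 j) /\ \sum_j a 0 j = 1 /\
           (forall j, ~~ A j -> a 0 j = 0)].

Definition hull A : set 'rV[R]_d := (fun a : 'rV[R]_N => a *m X) @` weights A.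

Lemma hull_convex (A : pred 'I_N) : convex (hull A).
Proof.
move=> _ _ t [a [a0 [a1 aA]] <-] [b [b0 [b1 bA]] <-] t0 t1.
exists ((1 - t) *: a + t *: b); last by rewrite mulmxDl !scalemxAl.
split=> [j|]; first by rewrite !mxE addr_ge0 // mulr_ge0 // subr_ge0.
split=> [|j Aj]; last by rewrite !mxE aA // bA // !mulr0 addr0.
under eq_bigr do rewrite !mxE.
by rewrite big_split /= -!mulr_sumr a1 b1; lra.
Qed.

Lemma hull_mem (A : pred 'I_N) j : A j -> hull A (row j X).
Proof.
move=> Aj; exists (delta_mx 0 j); last by rewrite rowE.
split=> [i|]; first by rewrite !mxE; rewrite ler0n.
split=> [|i Ai].
  rewrite (bigD1 j) //= big1 ?mxE ?eqxx ?addr0 // => i ij.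
  by rewrite !mxE eqxx (negbTE ij).
by rewrite !mxE; case: (eqVneq i j) Ai => [->|]; rewrite ?Aj ?andbF.
Qed.

Lemma hull_compact (A : pred 'I_N) : compact (hull A).
Proof.
apply: continuous_compact.
  by apply: continuous_subspaceT; exact: mulmxr_continuous.
pose cube := [set v : 'rV[R]_N | forall i, v ord0 i \in `[(0 : R), 1]].
have cubec : compact cube.
  apply: (@rV_compact R N (fun=> `[(0 : R), 1]%classic)) => i; exact: segment_compact.
apply: (subclosed_compact (B := cube)) => //.
  have -> : weights A = (\bigcap_j [set a : 'rV[R]_N | 0 <= a 0 j]) `&`
     [set a | \sum_j a 0 j = 1] `&` \bigcap_(j in [set j | ~~ A j]) [set a | a 0 j = 0].
    apply/seteqP; split=> a.
      by move=> [h1 [h2 h3]]; split; [split|] => [j _||j]; [exact: h1|exact: h2|exact: h3].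
    by move=> [[h1 h2] h3]; split=> [j|]; [exact: h1|split => //; exact: h3].
  apply: closedI; first apply: closedI.
  - apply: closed_bigI => j _; apply: (preimage_closed _ (@closed_ge R 0)) => x _.
    exact: coord_continuous.
  - apply: (preimage_closed _ (@closed_eq R (1 : R))) => x _.
    by apply: (continuous_big add_continuous) => j _; exact: coord_continuous.
  - apply: closed_bigI => j _; apply: (preimage_closed _ (@closed_eq R (0 : R))) => x _.
    exact: coord_continuous.
move=> a [a0 [a1 _]] i /=; rewrite in_itv /= a0 /= -a1.
by rewrite (bigD1 i) //= lerDl sumr_ge0.
Qed.

Lemma hull_sub (A : pred 'I_N) (K : set 'rV[R]_d) : convex K -> (forall j, A j -> K (row j X)) ->
  hull A `<=` K.
Proof.
move=> cK AK _ [a [a0 [a1 aA]] <-].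
rewrite mulmx_sum_row.
(* Partial sums are normalised by their total weight, so that each further point enters through a
   combination of two points. *)
suff key (s : seq 'I_N) : 0 < \sum_(j <- s) a 0 j ->
    K ((\sum_(j <- s) a 0 j)^-1 *: \sum_(j <- s) a 0 j *: row j X).
  have := key (index_enum 'I_N); rewrite a1 invr1 scale1r; exact.
elim: s => [|j s IH]; first by rewrite big_nil ltxx.
rewrite !big_cons; set W := \sum_(_ <- s) _; set Y := \sum_(_ <- s) _.
have W0 : 0 <= W by apply: sumr_ge0.
have [W00|Wn0] := eqVneq W 0.
  have -> : Y = 0.
    move: W00; rewrite /Y /W; elim: {IH W W0 Y}s => [|k s IH]; first by rewrite !big_nil.
    rewrite !big_cons => /eqP; rewrite paddr_eq0 // ?sumr_ge0 // => /andP[/eqP-> /eqP/IH->].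
    by rewrite scale0r addr0.
  rewrite W00 !addr0 => aj; rewrite scalerA mulVf ?gt_eqF // scale1r; apply: AK.
  by apply: contraTT aj => /aA ->; rewrite ltxx.
have Wp : 0 < W by rewrite lt_def Wn0.
move=> sp; have [aj0|ajn0] := eqVneq (a 0 j) 0.
  by rewrite aj0 scale0r !add0r; apply: IH.
have ajp : 0 < a 0 j by rewrite lt_def ajn0 a0.
have Kj : K (row j X).
  by apply: AK; apply: contraNT ajn0 => /aA ->.
have t0 : 0 <= W / (a 0 j + W) by rewrite divr_ge0 // ltW.
have t1 : W / (a 0 j + W) <= 1 by rewrite ler_pdivrMr // mul1r lerDr ltW.
have := cK _ _ _ Kj (IH Wp) t0 t1.
congr K; rewrite scalerA scalerDr scalerA; congr (_ *: _ + _ *: _); first by field; rewrite gt_eqF.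
by rewrite mulrAC divff ?mul1r // gt_eqF.
Qed.

End Hull.

(** One witness is chosen per simplex of the nerve, and each set is replaced by the hull of the
    witnesses of the simplices containing its index. These hulls are compact, and they lie in the
    old sets. *)
Lemma hull_nerve (R : realType) (I : finType) d (K : I -> set 'rV[R]_d) :
  (forall i, convex (K i)) -> exists K' : I -> set 'rV[R]_d,
  [/\ forall i, convex (K' i), forall i, compact (K' i) &
      forall s, nerve K s <-> nerve K' s].
Proof.
move=> cK.
have /choice[p pP] : forall s, exists x : 'rV[R]_d,
    nerve K s -> forall i, i \in s -> K i x.
  move=> s.
  by have [[x hx]|h] := pselect (nerve K s); [exists x|exists 0].
pose X := \matrix_(j < #|{set I}|) p (enum_val j).
pose A i := [pred j : 'I_#|{set I}| | (i \in enum_val j) && `[< nerve K (enum_val j) >]].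
exists (fun i => hull X (A i)); split=> [i|i|s].
- exact: hull_convex.
- exact: hull_compact.
split=> [Ks|[x hx]].
  exists (p s) => i his.
  have <- : row (enum_rank s) X = p s by rewrite rowK enum_rankK.
  by apply: hull_mem; rewrite /A /= enum_rankK his; apply/asboolP.
exists x => i his; apply: (hull_sub (cK i) _ (hx i his)) => j /andP[ij /asboolP Kj].
by rewrite rowK; apply: pP.
Qed.

Lemma rV_eta (R : nmodType) d (x : 'rV[R]_(1 + d)) :
  row_mx (x 0 0)%:M (rsubmx x) = x.
Proof.
rewrite -[RHS]hsubmxK; congr row_mx.
by apply/rowP => j; rewrite !ord1 !mxE eqxx mulr1n; congr (x 0 _); exact/val_inj.
Qed.

Lemma row_mx_head (R : nmodType) d (t : R) (y : 'rV[R]_d) :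
  row_mx (t%:M : 'rV_1) y 0 0 = t.
Proof. by rewrite mxE split1 unlift_none /= mxE eqxx. Qed.

Lemma row_mx_comb (R : comNzRingType) d (t u : R) (y y' : 'rV[R]_d) :
  (1 - u) *: row_mx (t%:M : 'rV_1) y + u *: row_mx (t%:M : 'rV_1) y' =
  row_mx (t%:M : 'rV_1) ((1 - u) *: y + u *: y').
Proof.
rewrite !scale_row_mx add_row_mx; congr row_mx.
by rewrite -scalerDl subrK scale1r.
Qed.

(** * Sweeping by parallel hyperplanes *)

Section Slabs.
Variables (R : realType) (I : finType) (d : nat) (K : I -> set 'rV[R]_d.+1).

Definition slab (a b : R) (s : {set I}) :=
  exists x : 'rV[R]_d.+1, [/\ a <= x 0 0, x 0 0 <= b & forall i, i \in s -> K i x].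

Lemma slab_down a b : down_closed (slab a b).
Proof.
by move=> i s [x [ax xb hx]]; exists x; split=> // j js; apply: hx; rewrite !inE js orbT.
Qed.

Lemma slab_sub a b a' b' s : a' <= a -> b <= b' -> slab a b s -> slab a' b' s.
Proof.
move=> aa bb [x [ax xb hx]]; exists x; split=> //.
- exact: le_trans ax.
- exact: le_trans bb.
Qed.

Lemma slab_split a b c s : slab a c s -> slab a b s \/ slab b c s.
Proof.
move=> [x [ax xc hx]]; have [xb|bx] := leP (x 0 0) b; first by left; exists x.
by right; exists x; split=> //; exact: ltW.
Qed.

Hypothesis cK : forall i, convex (K i).

(** The segment between the two points crosses height [b] inside every convex set of [s]. *)
Lemma slab_meet a b c s : slab a b s -> slab b c s -> slab b b s.
Proof.
move=> [x [ax xb hx]] [y [yb yc hy]].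
have [xy|xy] := eqVneq (x 0 0) (y 0 0).
  by exists x; split=> //; rewrite xy.
have xy' : x 0 0 < y 0 0 by rewrite lt_neqAle xy (le_trans xb).
pose t := (b - x 0 0) / (y 0 0 - x 0 0).
have yx0 : 0 < y 0 0 - x 0 0 by rewrite subr_gt0.
exists ((1 - t) *: x + t *: y).
have -> : ((1 - t) *: x + t *: y) 0 0 = b.
  by rewrite !mxE /t; field; rewrite gt_eqF.
split=> // i his; apply: cK; [exact: hx|exact: hy| |].
- by rewrite divr_ge0 ?subr_ge0 // ltW.
- by rewrite ler_pdivrMr // mul1r lerB.
Qed.

Lemma slab_pointE t s : slab t t s <->
  nerve (fun i => [set y : 'rV[R]_d | K i (row_mx t%:M y : 'rV_(1 + d))]) s.
Proof.
split=> [[x [tx xt hx]]|[y hy]].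
  exists (rsubmx (x : 'rV_(1 + d))) => i /hx /=.
  have -> : t = x 0 0 by apply/eqP; rewrite eq_le tx.
  by rewrite rV_eta.
exists (row_mx t%:M y : 'rV_(1 + d)); split => //.
  by rewrite row_mx_head.
by rewrite row_mx_head.
Qed.

Lemma slice_convex t i : convex [set y : 'rV[R]_d | K i (row_mx t%:M y : 'rV_(1 + d))].
Proof.
move=> y y' u Ky Ky' u0 u1 /=.
have := cK Ky Ky' u0 u1; congr (K i); exact: row_mx_comb.
Qed.

Hypothesis compK : forall i, compact (K i).

(** The heights attained on a common intersection form a closed set, so a simplex absent at height
    [t] is absent nearby, and there are finitely many simplices. *)
Lemma slab_usc t : exists2 e, 0 < e & forall s, slab (t - e) (t + e) s -> slab t t s.
Proof.
have key s : \forall e \near 0^'+, slab (t - e) (t + e) s -> slab t t s.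
  (* The empty simplex is treated apart: an intersection over no index is the whole space, which is
     not compact. *)
  have [->|[i his]] := set_0Vmem s.
    near=> e => _; exists (const_mx t); split=> [||i]; rewrite ?mxE ?inE //.
  have cp : compact (\bigcap_(j in [set j | j \in s]) K j).
    apply: (@subclosed_compact _ _ (K i)) => [|//|x]; last exact.
    by apply: closed_bigI => j _; apply: compact_closed.
  pose C := (fun x : 'rV[R]_d.+1 => x 0 0) @` \bigcap_(j in [set j | j \in s]) K j.
  have cC : closed C.
    apply: compact_closed; first exact: (@norm_hausdorff _ R^o).
    by apply: continuous_compact cp; apply: continuous_subspaceT; exact: coord_continuous.
  have [[x hx xt]|nC] := pselect (C t).
    by near=> e => _; exists x; rewrite xt; split=> // j js; exact: hx.
  have : nbhs t (~` C) by apply: open_nbhs_nbhs; split=> //; exact: closed_openC.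
  move=> /nbhs_ballP[r /= r0 br].
  near=> e => -[x [tx xt hx]]; exfalso; apply: (br (x 0 0)); last first.
    by exists x => // j js; exact: hx.
  rewrite /ball /= ltr_norml.
  have er : e < r by near: e; exact: nbhs_right_lt.
  by apply/andP; split; lra.
have [e /= [e0 he]] : exists e : R, 0 < e /\ forall s, slab (t - e) (t + e) s -> slab t t s.
  suff : \forall e \near 0^'+, 0 < e /\ forall s, slab (t - e) (t + e) s -> slab t t s.
    by move=> /filter_ex.
  near=> e; split; first by near: e; exact: nbhs_right_gt.
  by near: e; apply: filter_forall.
by exists e.
Unshelve. all: by end_near. Qed.

(** Near the supremum [t] of the good upper ends, the added slab has the nerve of the slice at [t],
    so Mayer-Vietoris carries acyclicity past [t]. *)
Lemma slab_acyclic q : (forall t, acyclic (slab t t) q) ->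
  (forall t, acyclic (slab t t) q.+1) -> forall a b, a <= b -> acyclic (slab a b) q.+1.
Proof.
move=> aq aq1 a b ab.
pose G := [set t | a <= t /\ t <= b /\ acyclic (slab a t) q.+1].
have Ga : G a by split.
have supG : has_sup G by split; [exists a|exists b => t [_ []]].
pose t := sup G.
have at_ : a <= t by apply: ub_le_sup => //; case: supG.
have tb : t <= b by apply: ge_sup => //; [exists a|move=> u [_ []]].
have [e e0 he] := slab_usc t.
have [u Gu tu] : exists2 u, G u & t - e < u.
  by apply: sup_adherent => //.
have [au [ub acu]] := Gu.
have ut : u <= t by apply: ub_le_sup => //; case: supG.
have step v : t <= v -> v <= t + e -> acyclic (slab a v) q.+1.
  move=> tv vt.
  have uv : u <= v := le_trans ut tv.
  apply: (@MV_acyclic _ _ (slab a u) (slab u v) (slab u u)) => //.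
  - exact: slab_down.
  - exact: slab_down.
  - by move=> s; apply: slab_split.
  - by move=> s; apply: slab_meet.
  - by move=> s; apply: slab_sub.
  - by move=> s; apply: slab_sub.
  - by move=> s; apply: slab_sub.
  - by move=> s; apply: slab_sub.
  apply: (acyclicW _ (aq1 t)) => s; split; first exact: slab_sub.
  by move=> h; apply: he; apply: slab_sub h; rewrite // ltW.
have [bt|tb'] := leP b (t + e).
  exact: step.
have Gte : G (t + e).
  split; first by rewrite (le_trans at_) // lerDl ltW.
  by split; [exact: ltW|apply: step; rewrite // lerDl ltW].
have : t + e <= t by apply: ub_le_sup => //; case: supG.
by rewrite gerDl leNgt e0.
Qed.

End Slabs.

(** Induction on [d]: after passage to compact sets, the slices at fixed first coordinate are nerves
    in one dimension less. *)
Theorem convex_nerve_acyclic (R : realType) (I : finType) d q (K : I -> set 'rV[R]_d) :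
  (forall i, convex (K i)) -> (d < q)%N -> acyclic (nerve K) q.
Proof.
elim: d q K => [|d IH] q K0 cK0 dq.
  move=> z hz z0; have [->|zn0] := eqVneq z 0.
    by exists 0; [exact: chain_on0|exact: bd0].
  have [s zs] : exists s, z s != 0.
    apply: contrapT => h; case/eqP: zn0; apply/ffunP => s; rewrite ffunE.
    by apply: contrapT => /eqP ?; apply: h; exists s.
  have [[x hx] qs] := hz s zs.
  (* The space is a single point, so any vertex of a simplex in the nerve is an apex. *)
  have /card_gt0P[v vs] : (0 < #|s|)%N by apply: leq_trans dq qs.
  apply: (@cone_acyclic _ _ _ v) => // s' [y hy]; exists y => i.
  rewrite !inE => /orP[/eqP->|/hy//].
  suff -> : y = x by apply: hx.
  by apply/rowP => -[].
have [K [cK compK nK]] := hull_nerve cK0.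
suff : acyclic (nerve K) q by apply: acyclicW => s; apply: iff_sym.
have [M M0 hM] : exists2 M : R, 0 <= M & forall i x, K i x -> `|x 0 0| <= M.
  have /choice[M hM] : forall i, exists M : R, 0 <= M /\ forall x, K i x -> `|x 0 0| <= M.
    move=> i; have : compact ((fun x : 'rV[R]_d.+1 => x 0 0) @` K i).
      by apply: continuous_compact; first
        (apply: continuous_subspaceT; exact: coord_continuous).
    move=> /compact_bounded[M [_ bM]]; exists (`|M| + 1); split.
      by rewrite addr_ge0.
    move=> x Kx; apply: (bM (`|M| + 1)); last by exists x.
    by rewrite (le_lt_trans (ler_norm _)) // ltrDl.
  exists (\sum_i M i); first by apply: sumr_ge0 => i _; exact: (hM i).1.
  move=> i x Kx; apply: le_trans ((hM i).2 x Kx) _.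
  by rewrite (bigD1 i) //= lerDl sumr_ge0 // => j _; exact: (hM j).1.
case: q dq => // q dq.
have ac : acyclic (slab K (- M) M) q.+1.
  apply: slab_acyclic => //.
  - move=> t; apply: acyclicW (IH q _ _ _).
    + by move=> s; apply: iff_sym; exact: slab_pointE.
    + by move=> i; exact: slice_convex.
    + by [].
  - move=> t; apply: acyclicW (IH q.+1 _ _ _).
    + by move=> s; apply: iff_sym; exact: slab_pointE.
    + by move=> i; exact: slice_convex.
    + exact: ltnW.
  - lra.
apply: acyclicW ac => s; split=> [[x [_ _ hx]]|[x hx]]; first by exists x.
have [s0|[i his]] := set_0Vmem s.
  exists 0; rewrite mxE; split; [lra|done|] => i; by rewrite s0 inE.
by exists x; have := hM i x (hx i his); rewrite ler_norml => /andP[].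
Qed.

(** * Nerves of convex cones *)

Section Cones.
Variable R : realType.

Definition cone n (C : set 'rV[R]_n) := forall x (a : R), C x -> 0 < a -> C (a *: x).

(** Openness along rays suffices to push points off a hyperplane, and it passes to slices. *)
Definition linearly_open n (C : set 'rV[R]_n) := forall x v, C x ->
  exists2 e : R, 0 < e & forall t, 0 < t -> t < e -> C (x + t *: v).

Lemma comb_mxE m n (t : R) (x y : 'M[R]_(m, n)) i j :
  ((1 - t) *: x + t *: y) i j = (1 - t) * x i j + t * y i j.
Proof. by rewrite !mxE. Qed.

(** Scaling moves common points into the affine hyperplane where [h] equals 1, so the nerve is one
    of convex sets in dimension [d]. *)
Lemma half_space_acyclic (I : finType) d q (C : I -> set 'rV[R]_d.+1) (h : 'cV[R]_d.+1) :
  (forall i, convex (C i)) -> (forall i, cone (C i)) ->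
  (forall i x, C i x -> 0 < (x *m h) 0 0) -> (d < q)%N -> acyclic (nerve C) q.
Proof.
move=> cC coC hC dq; have [h0|hn0] := eqVneq h 0.
  (* For [h = 0] the cones are empty, and the empty simplex has fewer than [q] vertices. *)
  have C0 i x : ~ C i x by move=> /hC; rewrite h0 mulmx0 mxE ltxx.
  move=> z hz _; exists 0; rewrite ?bd0; first exact: chain_on0.
  apply/esym/ffunP => s; rewrite ffunE; apply: contrapT => /eqP /hz [[x hx]].
  have [->|[i /hx /C0//]] := set_0Vmem s.
  by rewrite cards0 leqn0 => /eqP q0; rewrite q0 ltn0 in dq.
(* By rank factorisation, [h] is [mu] times the first coordinate after the change of basis [g]. *)
pose g := col_ebase h; pose mu := row_ebase h 0 0.
have ug : g \in unitmx by exact: col_ebase_unit.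
have mun0 : mu != 0.
  have := row_ebase_unit h; rewrite unitmxE (mx11_scalar (row_ebase h)) det_scalar1.
  by rewrite unitfE.
have r1 : \rank h = 1%N.
  by apply/eqP; rewrite eqn_leq rank_leq_col lt0n mxrank_eq0.
have hE x : (x *m h) 0 0 = (x *m g) 0 0 * mu.
  rewrite -{1}(mulmx_ebase h) r1 !mulmxA [LHS]mxE big_ord1; congr (_ * _).
  rewrite mxE (bigD1 0) //= big1 ?addr0; first by rewrite [X in _ * X]mxE eqxx mulr1.
  by move=> j j0; rewrite [X in _ * X]mxE (_ : (_ == _) = false) ?mulr0 //; apply/negbTE.
pose K i := [set y : 'rV[R]_d.+1 | C i (y *m invmx g)].
have cK i : convex (K i).
  by move=> x y t Kx Ky t0 t1; rewrite /K /= mulmxDl -!scalemxAl; exact: cC.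
apply: (@acyclicW _ (slab K mu^-1 mu^-1)) => [s|].
  split=> [[y [_ _ hy]]|[x hx]]; first by exists (y *m invmx g).
  have [s0|[i his]] := set_0Vmem s.
    exists (const_mx mu^-1); rewrite mxE; split=> // i; by rewrite s0 inE.
  have := hC i x (hx i his); rewrite hE; set y0 := (x *m g) 0 0 => ypos.
  have E : ((y0 * mu)^-1 *: (x *m g)) 0 0 = mu^-1.
    rewrite mxE -/y0 invfM mulrC mulrA divff ?mul1r //.
    by apply: contraTneq ypos => ->; rewrite mul0r ltxx.
  exists ((y0 * mu)^-1 *: (x *m g)); rewrite E; split=> // j js.
  rewrite /K /= -scalemxAl mulmxK //; apply: coC; first exact: hx.
  by rewrite invr_gt0.
have := convex_nerve_acyclic (@slice_convex _ _ _ _ cK mu^-1) dq; apply: acyclicW => s.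
by apply: iff_sym; exact: slab_pointE.
Qed.

Lemma linearly_open_nerve (I : finType) n (C : I -> set 'rV[R]_n) (s : {set I}) x v :
  (forall i, linearly_open (C i)) -> (forall i, i \in s -> C i x) ->
  exists2 t : R, 0 < t & forall i, i \in s -> C i (x + t *: v).
Proof.
move=> oC hx.
have /choice[e he] : forall i, exists e : R, 0 < e /\
    (i \in s -> forall t, 0 < t -> t < e -> C i (x + t *: v)).
  move=> i; have [his|his] := boolP (i \in s); last by exists 1; split; rewrite ?ltr01.
  by have [e e0 eC] := oC i x v (hx i his); exists e.
pose t := (1 + \sum_i (e i)^-1)^-1.
have ei0 i : 0 < (e i)^-1 by rewrite invr_gt0; exact: (he i).1.
have S0 : 0 <= \sum_i (e i)^-1 by apply: sumr_ge0 => i _; exact: ltW.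
exists t; first by rewrite invr_gt0 ltr_pwDl.
move=> i his; apply: (he i).2 => //; first by rewrite invr_gt0 ltr_pwDl.
rewrite /t -[ltRHS]invrK ltf_pV2 ?posrE ?ltr_pwDl //.
rewrite (bigD1 i) //= lerDl.
by apply: sumr_ge0 => j _; exact: ltW.
Qed.

(** Induction on [n], cutting by the hyperplane where the first coordinate vanishes. Both open sides
    are acyclic by [half_space_acyclic], and their intersection is the nerve of the cones inside the
    hyperplane. *)
Theorem cone_nerve_one_class (I : finType) n (C : I -> set 'rV[R]_n) :
  (forall i, convex (C i)) -> (forall i, cone (C i)) ->
  (forall i, linearly_open (C i)) -> (forall i, ~ C i 0) ->
  one_class (nerve C) n.
Proof.
elim: n C => [|n IH] C cC coC oC C0.
  (* In dimension 0 the cones are empty; only the empty simplex remains, and it carries one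
     class. *)
  have nC s : nerve C s -> s = finset.set0.
    move=> [x hx]; apply/eqP; rewrite -finset.subset0; apply/fintype.subsetP => i /hx.
    by rewrite (_ : x = 0) => [/C0//|]; apply/rowP => -[].
  have zE z : chain_on (nerve C) 0 z -> z finset.set0 = 0 -> z = 0.
    move=> hz z0; apply/ffunP => s; rewrite ffunE.
    by apply: contrapT => /eqP zs; move: (zs); rewrite (nC _ (hz _ zs).1) z0 eqxx.
  have b0 : bounds (nerve C) 0 (0 : {ffun {set I} -> 'F_2}).
    by exists 0; [exact: chain_on0|exact: bd0].
  move=> z z' hz hz' _ _.
  have [/(zE _ hz) ->|/F2_neq0 z1] := eqVneq (z finset.set0) 0; first by constructor 1.
  have [/(zE _ hz') ->|/F2_neq0 z1'] := eqVneq (z' finset.set0) 0; first by constructor 2.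
  constructor 3; rewrite (zE (z + z')) //; first exact: chain_onD.
  by rewrite ffunE z1 z1' F2_addrr.
pose D (Q : R -> Prop) (s : {set I}) := exists x : 'rV[R]_n.+1, Q (x 0 0) /\ forall i, i \in s -> C i x.
have Ddown Q : down_closed (D Q).
  by move=> i s [x [Qx hx]]; exists x; split=> // j js; apply: hx; rewrite !inE js orbT.
have DN Q s : D Q s -> nerve C s by move=> [x [_ hx]]; exists x.
pose e0 : 'rV[R]_n.+1 := delta_mx 0 0.
have e0E x t : (x + t *: e0) 0 0 = x 0 0 + t by rewrite !mxE !eqxx mulr1.
(* Openness pushes a common point off the hyperplane, so simplices of the slice belong to both
   sides. *)
have D0p s : D (eq^~ 0) s -> D (fun t => 0 < t) s.
  move=> [x [x0 hx]]; have [t t0 ht] := linearly_open_nerve e0 oC hx.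
  by exists (x + t *: e0); rewrite e0E x0 add0r.
have D0n s : D (eq^~ 0) s -> D (fun t => t < 0) s.
  move=> [x [x0 hx]]; have [t t0 ht] := linearly_open_nerve (- e0) oC hx.
  by exists (x + t *: (- e0)); rewrite scalerN -scaleNr e0E x0 add0r oppr_lt0 scaleNr -scalerN.
(* The point satisfying [Q] serves the empty simplex, on which [K] imposes no condition. *)
have DA (h : 'cV[R]_n.+1) Q : (exists x : 'rV[R]_n.+1, Q (x 0 0)) ->
    (forall x : 'rV_n.+1, Q (x 0 0) <-> 0 < (x *m h) 0 0) -> acyclic (D Q) n.+1.
  move=> [x0 Qx0] hQ.
  pose K i := C i `&` [set x | 0 < (x *m h) 0 0].
  have aK : acyclic (nerve K) n.+1.
    apply: (@half_space_acyclic _ _ _ K h) => [i|i|i x []|] //.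
      move=> x y t [Cx hx] [Cy hy] t0 t1; split; first exact: cC.
      rewrite /= mulmxDl -!scalemxAl comb_mxE.
      have [->|tn0] := eqVneq t 0; first by rewrite subr0 mul1r mul0r addr0.
      rewrite ltr_wpDl ?mulr_ge0 ?mulr_gt0 ?subr_ge0 ?(ltW hx) //.
      by rewrite lt_def tn0.
    move=> x a [Cx hx] a0; split; first exact: coC.
    by rewrite /= -scalemxAl mxE mulr_gt0.
  apply: acyclicW aK => s; split=> [[x hx]|[x [Qx hx]]]; last first.
    by exists x => i his; split; [exact: hx|apply/hQ].
  have [->|[i his]] := set_0Vmem s.
    by exists x0; split=> // i; rewrite inE.
  by exists x; split; [apply/hQ; exact: (hx i his).2|move=> j /hx[]].
have h0E (x : 'rV[R]_n.+1) : (x *m (delta_mx 0 0 : 'cV_n.+1)) 0 0 = x 0 0.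
  rewrite mxE (bigD1 0) //= big1 ?addr0 => [|j /negbTE j0].
    by rewrite mxE !eqxx mulr1.
  by rewrite mxE j0 mulr0.
apply: (@MV_class _ _ (D (fun t => 0 < t)) (D (fun t => t < 0)) (D (eq^~ 0))) => //.
- move=> s [x hx]; have [xn|xp|x0] := ltgtP (x 0 0) 0.
  + by right; exists x.
  + by left; exists x.
  + by left; apply: D0p; exists x.
- move=> s [x [x0 hx]] [y [y0 hy]].
  have xy : 0 < x 0 0 - y 0 0 by rewrite subr_gt0 (lt_trans y0).
  pose t := x 0 0 / (x 0 0 - y 0 0).
  exists ((1 - t) *: x + t *: y); split.
    by rewrite !mxE /t; field; rewrite gt_eqF.
  move=> i his; apply: cC; [exact: hx|exact: hy| |].
    by rewrite divr_ge0 ?ltW.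
  by rewrite ler_pdivrMr // mul1r lerBrDl gerDr ltW.
- by move=> s; apply: DN.
- by move=> s; apply: DN.
- apply: (DA (delta_mx 0 0)) => [|x]; last by rewrite h0E.
  by exists e0; rewrite !mxE !eqxx ltr01.
- apply: (DA (- delta_mx 0 0)) => [|x]; last by rewrite mulmxN mxE h0E oppr_gt0.
  by exists (- e0); rewrite !mxE !eqxx oppr_lt0 ltr01.
pose K i := [set y : 'rV[R]_n | C i (row_mx 0%:M y : 'rV_(1 + n))].
apply: (@one_classW _ (nerve K)) => [s|].
  apply: (iff_trans (iff_sym (slab_pointE C 0 s))).
  split=> [[x [x0 x0' hx]]|[x [x0 hx]]]; exists x; last by rewrite x0; split.
  by split=> //; apply/eqP; rewrite eq_le x0'.
apply: IH => i.
- exact: slice_convex.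
- move=> y a Ky a0; rewrite /K /=.
  have := coC i _ a Ky a0; congr (C i).
  by rewrite [LHS](scale_row_mx a (0%:M : 'M[R]_1) y) scale_scalar_mx mulr0.
- move=> y v Ky.
  have [e e_gt0 he] := oC i _ (row_mx 0%:M v : 'rV_(1 + n)) Ky.
  exists e => // t t0 te; have := he t t0 te; rewrite /K /=; congr (C i).
  rewrite [X in _ + X](scale_row_mx t (0%:M : 'M[R]_1) v) scale_scalar_mx mulr0.
  by rewrite [LHS](add_row_mx (0%:M : 'M[R]_1) y) -raddfD addr0.
- move=> K0; apply: (C0 i); move: K0; rewrite /K /=; congr (C i).
  rewrite raddf0; apply: (@row_mx0 _ 1 1 n).
Qed.
End Cones.

Local Close Scope classical_set_scope.

(** * Upper bounds on the number of realizable tuples *)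

Section Realizable.
Variables (R : realType) (n m K : nat) (k : 'I_m -> nat).
Variable C : 'I_m -> 'I_K.+1 -> set 'rV[R]_n.
Notation tup := {ffun 'I_m -> 'I_K.+1}.
Notation F2fun := {ffun tup -> 'F_2}.

Definition realizable : {set tup} := [set c : tup | `[< exists x, forall i, C i (c i) x >]].

Hypothesis k_gt0 : forall i, (0 < k i)%N.
Hypothesis disjC : forall i r r' x, C i r x -> C i r' x -> r = r'.
Hypothesis ltC : forall i r x, C i r x -> (r < k i)%N.
Hypothesis cC : forall i r, convex (C i r).

Definition supported (w : F2fun) := forall c, w c != 0 -> c \in realizable.

Lemma supported_realized w S : supported w -> realized C S w.
Proof.
by move=> sw c /sw; rewrite inE => /asboolP[x hx]; exists x => i _; exact: hx.
Qed.

Lemma supported_lt w : supported w -> forall c, w c != 0 -> forall i, (c i < k i)%N.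
Proof. by move=> sw c /sw; rewrite inE => /asboolP[x hx] i; exact: ltC (hx i). Qed.

Lemma fam_convex S x : convex (fam C S x).
Proof. by move=> y z t [xS Cy] [_ Cz] t0 t1; split=> //; exact: cC. Qed.

Lemma mchainT_eq0 (w : F2fun) : mchain w finset.setT = 0 -> w = 0.
Proof.
move=> /mchain0P h; apply/ffunP => c; rewrite [RHS]ffunE -[RHS](h c) /marg.
rewrite (bigD1 c) /=; last by apply/forall_inP.
rewrite big1 ?addr0 // => c' /andP[/forall_inP ag nc]; case/eqP: nc.
by apply/ffunP => i; apply/eqP/ag; rewrite inE.
Qed.

Theorem card_realizable : (#|realizable| <= #|box_le K k n|)%N.
Proof.
apply: (@card_le_kernel _ _ _ _ (fun w a => marg w (supp a) a)).
  by move=> w w' b; exact: margB.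
move=> w sw red; apply: mchainT_eq0.
have low := marg_eq0 k_gt0 (supported_lt sw) red.
(* Induction on the number of units beyond [n]; the marginal on all units recovers [w]. *)
suff all N (S : {set 'I_m}) : (#|S| <= n + N)%N -> mchain w S = 0.
  by apply: (all m); rewrite (leq_trans (max_card _)) // card_ord leq_addl.
elim: N S => [|N IH] S; first by rewrite addn0; exact: low.
rewrite addnS leq_eqVlt ltnS => /orP[/eqP SN|]; last exact: IH.
apply: (acyclic_mchain disjC) => [||i iS].
- apply: convex_nerve_acyclic; first exact: fam_convex.
  by rewrite SN ltnS leq_addr.
- exact: supported_realized.
- by apply: IH; rewrite -ltnS -SN [ltnRHS](cardsD1 i) iS.
Qed.
End Realizable.

(** * Upper bound when the cells are cones *)

Section Central.
Variables (R : realType) (d m K : nat) (k : 'I_m -> nat).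
Variable C : 'I_m -> 'I_K.+1 -> set 'rV[R]_d.+1.
Variable eff : {set 'I_m}.
Notation tup := {ffun 'I_m -> 'I_K.+1}.
Notation F2fun := {ffun tup -> 'F_2}.

Hypothesis k_gt0 : forall i, (0 < k i)%N.
Hypothesis disjC : forall i r r' x, C i r x -> C i r' x -> r = r'.
Hypothesis ltC : forall i r x, C i r x -> (r < k i)%N.
Hypothesis cC : forall i r, convex (C i r).
Hypothesis coC : forall i r, cone (C i r).
Hypothesis oC : forall i r, linearly_open (C i r).
Hypothesis hC : forall i r, i \in eff ->
  exists h : 'cV[R]_d.+1, forall x, C i r x -> 0 < (x *m h) 0 0.
Hypothesis neff : forall i, i \notin eff -> exists r0, forall r x, C i r x -> r = r0.

Let fam_cone S x : cone (fam C S x).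
Proof. by move=> y a [xS Cy] a0; split=> //; exact: coC. Qed.

Let fam_open S x : linearly_open (fam C S x).
Proof. by move=> y v [xS /(oC v)[e e0 he]]; exists e => // t t0 te; split=> //; exact: he. Qed.

Let fam0 (S : {set 'I_m}) x : S \subset eff -> ~ fam C S x 0.
Proof.
move=> /fintype.subsetP Se [/Se xe Cx]; have [h /(_ _ Cx)] := hC x.2 xe.
by rewrite mul0mx mxE ltxx.
Qed.

Let kernel (w : F2fun) := supported C w /\
  forall a, a \in box_le K k d -> marg w (supp a) a = 0.

Let kernel_low w : kernel w -> forall S : {set 'I_m}, (#|S| <= d)%N -> mchain w S = 0.
Proof. by move=> [sw red]; apply: (marg_eq0 k_gt0 (supported_lt ltC sw)). Qed.

Let kernel_lowD w (S : {set 'I_m}) : kernel w -> #|S| = d.+1 ->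
  forall i, i \in S -> mchain w (S :\ i) = 0.
Proof.
move=> kw Sd i iS; apply: kernel_low => //.
by rewrite -ltnS -Sd [ltnRHS](cardsD1 i) iS.
Qed.

(* Marginals of kernel elements on [d + 1] units are cycles in nerves of cones, so they
   span at most a line over [F_2], and a single value detects them. *)
Let kernel_test (S : {set 'I_m}) : exists a : tup, S \subset eff -> #|S| = d.+1 ->
  forall w, kernel w -> marg w S a = 0 -> mchain w S = 0.
Proof.
have [h|] := pselect (S \subset eff /\ #|S| = d.+1 /\
  exists2 w0, kernel w0 & mchain w0 S != 0); last first.
  move=> h; exists [ffun=> ord0] => Se Sd w kw _; apply: contrapT => /eqP nz.
  by apply: h; split=> //; split=> //; exists w.
have [Se [Sd [w0 kw0 nz0]]] := h.
have [a0 ma0] : exists a, marg w0 S a != 0.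
  apply: contrapT => ha; case/eqP: nz0; apply/mchain0P => a.
  by apply: contrapT => /eqP ?; apply: ha; exists a.
exists a0 => _ _ w kw ma.
have oc : one_class (fnerve C S) #|S|.
  rewrite Sd; apply: cone_nerve_one_class => x.
  - exact: fam_convex.
  - exact: fam_cone.
  - exact: fam_open.
  - exact: fam0.
have rw w' : kernel w' -> realized C S w' by case=> sw _; exact: supported_realized.
have [e|//|e] := one_class_mchain disjC oc (rw _ kw0) (rw _ kw)
  (kernel_lowD kw0 Sd) (kernel_lowD kw Sd).
  by rewrite e eqxx in nz0.
by move: ma0; rewrite -mchain_face e mchain_face ma eqxx.
Qed.

(** On more than [d + 1] units the label of [i0] is frozen at [r]. All cells are then cut down to
    the cell of [i0], which lies in an open half-space, so the nerve over the other units is acyclic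
    at level [d + 1] and above. *)
Let kernel_zero w (i0 : 'I_m) : i0 \in eff -> kernel w ->
  (forall S : {set 'I_m}, S \subset eff -> i0 \in S -> #|S| = d.+1 -> mchain w S = 0) ->
  forall S : {set 'I_m}, S \subset eff -> i0 \in S -> mchain w S = 0.
Proof.
move=> ie kw top.
suff all N (S : {set 'I_m}) : (#|S| <= d.+1 + N)%N -> S \subset eff -> i0 \in S -> mchain w S = 0.
  by move=> S; apply: (all m); rewrite (leq_trans (max_card _)) // card_ord leq_addl.
elim: N S => [|N IH] S.
  rewrite addn0 leq_eqVlt ltnS => /orP[/eqP Sd|Sd] Se iS; first exact: top.
  exact: kernel_low.
rewrite addnS leq_eqVlt ltnS => /orP[/eqP SN|SN] Se iS; last exact: IH.
apply/mchain0P => a.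
pose r := a i0; pose S' := S :\ i0.
pose wr : F2fun := [ffun c : tup => if c i0 == r then w c else 0].
have wrE (T : {set 'I_m}) b : i0 \notin T -> marg wr T b = marg w (i0 |: T) (upd b i0 r).
  move=> iT; rewrite /marg big_mkcond [RHS]big_mkcond /=; apply: eq_bigr => c _.
  rewrite ffunE.
  have -> : agree (i0 |: T) c (upd b i0 r) = agree T c b && (c i0 == r).
    apply/forall_inP/andP => [h|[/forall_inP h cr] i].
      split; last by have := h i0; rewrite ffunE eqxx; apply; rewrite finset.setU11.
      apply/forall_inP => i iT'; have := h i; rewrite ffunE !inE iT' orbT.
      case: (eqVneq i i0) => [ii|_]; last exact.
      by rewrite -ii iT' in iT.
    rewrite !inE ffunE; case: (eqVneq i i0) => [->//|_] /=; exact: h.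
  by case: (agree T c b) => //=; case: ifP.
have -> : marg w S a = marg wr S' a.
  rewrite wrE; last by rewrite !inE eqxx.
  rewrite /S' finset.setD1K //.
  by apply: marg_agree; apply/forall_inP => i _; rewrite ffunE /r; case: (eqVneq i i0) => [->|].
suff wr0 : mchain wr S' = 0 by move/mchain0P: wr0; apply.
pose C' i q : set 'rV[R]_d.+1 := (C i q `&` C i0 r)%classic.
have [h hh] := hC r ie.
have cardS' : #|S'| = (d.+1 + N)%N by apply/eqP; rewrite -eqSS -SN (cardsD1 i0 S) iS.
apply: (@acyclic_mchain _ _ _ C' S') => [i q q' x [Cq _] [Cq' _]||c|i iS'].
- exact: disjC Cq Cq'.
- rewrite cardS'; apply: (half_space_acyclic (h := h)) => [x y z t|x y b|x y []|].
  + by move=> [xS [Cy Cy']] [_ [Cz Cz']] t0 t1; split=> //; split; exact: cC.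
  + by move=> [xS [Cy Cy']] b0; split=> //; split; exact: coC.
  + by move=> _ [_ /hh].
  + by rewrite addSn ltnS leq_addr.
- rewrite ffunE; case: (eqVneq (c i0) r) => [ci|_]; last by rewrite eqxx.
  move=> /(kw.1 c); rewrite inE => /asboolP[x hx]; exists x => i _; split; first exact: hx.
  by rewrite -ci; exact: hx.
apply/mchain0P => b; rewrite wrE; last by rewrite !inE eqxx andbF.
have i0i : i0 != i by move: iS'; rewrite !inE eq_sym => /andP[].
have -> : i0 |: (S' :\ i) = S :\ i.
  apply/setP => j; rewrite !inE; have [->|] //= := eqVneq j i0.
  by rewrite i0i iS.
suff /mchain0P : mchain w (S :\ i) = 0 by apply.
have iS2 : i \in S by move: iS'; rewrite !inE => /andP[].
apply: IH; last by rewrite !inE i0i.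
  by rewrite -ltnS -SN [ltnRHS](cardsD1 i) iS2.
by apply: fintype.subset_trans Se; exact: finset.subD1set.
Qed.

(** A unit outside [eff] has only one possible label: adding it to [S] keeps the marginal at that
    label and gives zero at the others. *)
Let kernel_full w : kernel w -> mchain w eff = 0 -> w = 0.
Proof.
move=> kw e0; apply: mchainT_eq0.
suff all N (S : {set 'I_m}) : (#|S :\: eff| <= N)%N -> eff \subset S -> mchain w S = 0.
  by apply: (all m); [rewrite (leq_trans (max_card _)) // card_ord|exact: finset.subsetT].
elim: N S => [|N IH] S.
  rewrite leqn0 cards_eq0 finset.setD_eq0 => Se eS.
  by rewrite (_ : S = eff) //; apply/eqP; rewrite finset.eqEsubset Se.
move=> SN eS; have [D0|[i]] := set_0Vmem (S :\: eff).
  by apply: IH => //; rewrite D0 cards0.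
rewrite inE => /andP[ie iS].
have /mchain0P Si : mchain w (S :\ i) = 0.
  apply: IH; last first.
    by apply/fintype.subsetP => j je; rewrite !inE (fintype.subsetP eS) // andbT;
      apply: contraNneq ie => <-.
  rewrite -ltnS (leq_trans _ SN) // [ltnRHS](cardsD1 i) !inE iS ie ltnS.
  by rewrite finset.setDDl finset.setUC -finset.setDDl.
apply/mchain0P => a; have [r0 hr0] := neff ie.
have crit c : w c != 0 -> c i = r0.
  by move=> /(kw.1 c); rewrite inE => /asboolP[x hx]; exact: hr0 (hx i).
have z r : r != r0 -> marg w S (upd a i r) = 0.
  move=> rr0; apply: big1 => c /forall_inP ag; apply: contrapT => /eqP /crit ci.
  by have := ag i iS; rewrite ffunE eqxx ci eq_sym (negbTE rr0).
have [ai|ai] := eqVneq (a i) r0.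
  have := marg_split w a iS; rewrite Si (bigD1 r0) //= big1 ?addr0 => [->|r]; last exact: z.
  apply: marg_agree; apply/forall_inP => j _; rewrite ffunE.
  by case: (eqVneq j i) => [->|]; rewrite ?ai.
rewrite -(z _ ai); apply: marg_agree; apply/forall_inP => j _; rewrite ffunE.
by case: (eqVneq j i) => [->|].
Qed.

Theorem card_realizable_central :
  (#|realizable C| <= (eff != finset.set0) * 'C(#|eff|.-1, d) + #|box_le K k d|)%N.
Proof.
have [eff0|[i0 ie]] := set_0Vmem eff.
  rewrite eff0 eqxx mul0n add0n.
  apply: (@card_le_kernel _ _ _ _ (fun w a => marg w (supp a) a)).
    by move=> w w' b; exact: margB.
  move=> w sw red; apply: kernel_full; first by split.
  by rewrite eff0; apply: kernel_low; [split|rewrite cards0].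
have -> : eff != finset.set0 by apply/set0Pn; exists i0.
rewrite mul1n.
have /choice[f hf] := kernel_test.
pose Ex := [set S : {set 'I_m} | [&& S \subset eff, i0 \in S & #|S| == d.+1]].
pose P := [set b : {set 'I_m} + tup |
  match b with inl T => T \in Ex | inr b' => b' \in box_le K k d end].
(* One bit per vector of the box, and one bit, at the tuple from [kernel_test], per set of [d + 1]
   effective units through [i0]. *)
pose ev (w : F2fun) (b : {set 'I_m} + tup) :=
  match b with inl T => marg w T (f T) | inr b' => marg w (supp b') b' end.
have : (#|realizable C| <= #|P|)%N.
  apply: (@card_le_kernel _ _ _ _ ev).
    by move=> w w' [S|a]; exact: margB.
  move=> w sw red.
  have kw : kernel w by split=> // a ab; apply: (red (inr a)); rewrite inE.
  apply: kernel_full => //.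
  apply: (kernel_zero ie kw) => // S Se iS Sd.
  by apply: hf => //; apply: (red (inl S)); rewrite !inE Se iS Sd eqxx.
move=> /leq_trans; apply.
have -> : P = (inl @: Ex) :|: (inr @: box_le K k d).
  apply/setP => -[S|a]; rewrite !inE.
    rewrite [X in _ || X](_ : _ = false) ?orbF; last by apply/imsetP => -[].
    by rewrite mem_imset ?inE //; move=> ? ? [].
  rewrite [X in X || _](_ : _ = false) ?orFb; last by apply/imsetP => -[].
  by rewrite mem_imset ?inE //; move=> ? ? [].
apply: leq_trans (leq_card_setU _ _) _.
rewrite !card_imset; [|by move=> ? ? []|by move=> ? ? []].
rewrite leq_add2r.
have -> : #|eff|.-1 = #|eff :\ i0| by rewrite (cardsD1 i0 eff) ie.
rewrite -cards_draws -(@card_in_imset _ _ (fun S => S :\ i0) Ex).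
  apply/subset_leq_card/fintype.subsetP => _ /imsetP[S + ->].
  rewrite !inE => /and3P[Se iS /eqP Sd].
  by rewrite finset.setSD //= -eqSS -Sd [in X in _ == X](cardsD1 i0) iS.
move=> S T; rewrite !inE => /and3P[_ iS _] /and3P[_ iT _] e.
by rewrite -(finset.setD1K iS) -(finset.setD1K iT) e.
Qed.

End Central.

Local Open Scope classical_set_scope.
Local Open Scope ring_scope.

(** * Linear regions of a layer *)

Lemma near_affine_diff (R : realType) n m (f : 'rV[R]_n -> 'rV[R]_m) (M : 'M[R]_(n, m)) v x :
  (\forall y \near x, f y = y *m M + v) ->
  differentiable f x /\ jacobian f x = M.
Proof.
move=> fM.
have oE : f \o shift x = cst (f x) + mulmxr M +o_ 0 id.
  apply/eqaddoP => e e0; have := fM; rewrite (near_shift 0) subr0 => fM0.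
  near=> h.
  have -> : (f \o shift x - (cst (f x) + mulmxr M)) h = 0.
    have hE : f (h + x) = (h + x) *m M + v by near: h.
    have xE := nbhs_singleton fM.
    rewrite !fctE /= hE xE mulmxDl /=.
    by apply/eqP; rewrite subr_eq0 -addrA addrC.
  by rewrite normr0 mulr_ge0 // ltW.
have cM : continuous (mulmxr M : 'rV[R]_n -> 'rV[R]_m) by exact: mulmxr_continuous.
have dE := diff_unique cM oE.
split.
  apply/diff_locallyP; rewrite dE; split=> //.
by rewrite /jacobian dE; apply/row_matrixP => i; rewrite rowE mul_rV_lin1 /= -rowE.
Unshelve. all: by end_near. Qed.

Lemma convex_connected (R : realType) n (K : set 'rV[R]_n) : convex K -> connected K.
Proof.
move=> cK; have [->|/set0P[x Kx]] := eqVneq K set0; first exact: connected0.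
pose seg y (t : R) := (1 - t) *: x + t *: y.
have -> : K = \bigcup_(y in K) (seg y @` `[0, 1]).
  apply/seteqP; split=> [y Ky|_ [y Ky] [t /= + <-]].
    by exists y => //; exists 1; rewrite /= ?in_itv /= ?ler01 ?lexx //
      /seg subrr scale0r scale1r add0r.
  by rewrite in_itv /= => /andP[t0 t1]; exact: cK.
apply: bigcup_connected.
  exists x => y Ky; exists 0; first by rewrite /= in_itv /= lexx ler01.
  by rewrite /seg subr0 scale1r scale0r addr0.
move=> y _; apply: connected_continuous_connected; first exact: segment_connected.
apply: continuous_subspaceT; apply: continuous_mx => i j.
under eq_fun do rewrite /seg !mxE.
move=> t; apply: cvgD; (apply: cvgM; last exact: cvg_cst); last exact: cvg_id.
by apply: cvgB; [exact: cvg_cst|exact: cvg_id].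
Qed.

(** Within [A], the set [U j] is open, and closed as the complement of the other members, so a
    component that meets it lies inside it. *)
Lemma open_cover_component (T : topologicalType) (J : Type) (U : J -> set T) (A : set T) j x :
  (forall j, open (U j)) -> (forall j, connected (U j)) ->
  (forall i j y, U i y -> U j y -> i = j) -> A = \bigcup_j U j -> U j x ->
  connected_component A x = U j.
Proof.
move=> oU cU dU AE Ujx; apply/seteqP; split; last first.
  by apply: connected_component_max => // y Ujy; rewrite AE; exists j.
set B := connected_component A x.
have BA : B `<=` A by exact: connected_component_sub.
suff <- : B `&` U j = B by move=> y [].
apply: (component_connected (A := A) (x := x)).
- by exists x; split=> //; apply: connected_component_refl; rewrite AE; exists j.
- by exists (U j).
exists (~` \bigcup_(i in [set i | i <> j]) U i).
  by apply: open_closedC; apply: bigcup_open => i _.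
apply/seteqP; split=> y [By].
  by move=> Ujy; split=> // -[i /= ij Uiy]; apply: ij; exact: dU Uiy Ujy.
move=> nU; split=> //; have := BA y By; rewrite AE => -[i _ Uiy].
by have [<-//|ij] := pselect (i = j); exfalso; apply: nU; exists i.
Qed.

Lemma card_finset_II (T : finType) (D : {set T}) : ([set` D] #= `I_#|D|)%card.
Proof.
have -> : [set` D] = (fun i : 'I_#|D| => enum_val i) @` setT.
  apply/seteqP; split=> [c /= cD|_ [i _ <-]]; last exact: enum_valP.
  by exists (enum_rank_in cD c) => //; rewrite enum_rankK_in.
apply: card_eq_trans (card_esym card_II).
apply: inj_card_eq => i j _ _; exact: enum_val_inj.
Qed.

(** * A single unit and its cells *)

Section Unit.
Variables (R : realType) (n k : nat) (A : 'M[R]_(k, n)) (b : 'rV[R]_k).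

Definition form (s : 'I_k) (x : 'rV[R]_n) : R := \sum_(j < n) A s j * x 0 j + b 0 s.

Definition slope (s : 'I_k) (v : 'rV[R]_n) : R := \sum_(j < n) A s j * v 0 j.

Lemma form_line s x v t : form s (x + t *: v) = form s x + t * slope s v.
Proof.
rewrite /form /slope mulr_sumr [RHS]addrAC -big_split /=; congr (_ + _).
by apply: eq_bigr => j _; rewrite !mxE; ring.
Qed.

Lemma formE s x : form s x = form s 0 + slope s x.
Proof. by have := form_line s 0 x 1; rewrite add0r scale1r mul1r. Qed.

Lemma form_convex s x y t :
  form s ((1 - t) *: x + t *: y) = (1 - t) * form s x + t * form s y.
Proof.
have -> : (1 - t) *: x + t *: y = x + t *: (y - x).
  by rewrite scalerBl scale1r scalerBr [LHS]addrAC addrA.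
rewrite form_line (formE s x) (formE s y).
have -> : slope s (y - x) = slope s y - slope s x.
  by rewrite /slope -sumrB; apply: eq_bigr => j _; rewrite !mxE; ring.
by ring.
Qed.

Lemma form_continuous s : continuous (form s).
Proof.
have cS : continuous (fun x : 'rV[R]_n => \sum_(j < n) A s j * x 0 j).
  apply: (continuous_big add_continuous) => j _ x.
  by apply: continuousM; [exact: cst_continuous|exact: coord_continuous].
move=> x; apply: (@continuousD _ _ _ _ (fun=> b 0 s)); first exact: cS.
exact: cst_continuous.
Qed.

Hypothesis k_gt0 : (0 < k)%N.

Lemma form_maxout_has_sup x : has_sup [set form s x | s in [set: 'I_k]].
Proof.
split; first by exists (form (Ordinal k_gt0) x), (Ordinal k_gt0).
exists (\big[Num.max/form (Ordinal k_gt0) x]_s form s x) => _ [s _ <-].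
by apply: le_bigmax.
Qed.

Lemma form_le_maxout s x : form s x <= maxout_unit A b x.
Proof. by apply: ub_le_sup; [case: (form_maxout_has_sup x)|exists s]. Qed.

Lemma maxout_eq s x : (forall s', form s' x <= form s x) -> maxout_unit A b x = form s x.
Proof.
move=> h; apply/eqP; rewrite eq_le form_le_maxout andbT.
by apply: ge_sup => [|_ [s' _ <-]]; [exists (form s x), s|exact: h].
Qed.

Lemma maxout_attained x : exists s, maxout_unit A b x = form s x.
Proof.
have [s _ hs] := @arg_maxP _ _ _ (Ordinal k_gt0) predT (fun s => form s x) isT.
by exists s; apply: maxout_eq => s'; apply: hs.
Qed.

(* Among identical affine forms only the one of least index owns a cell. *)
Definition beaten (r s : 'I_k) (x : 'rV[R]_n) :=
  form s x < form r x \/ ((forall y, form s y = form r y) /\ (r < s)%N).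

Definition unit_cell (r : 'I_k) : set 'rV[R]_n := [set x | forall s : 'I_k, s != r -> beaten r s x].

Lemma unit_cell_le r x : unit_cell r x -> forall s, form s x <= form r x.
Proof.
move=> h s; have [->//|/h[/ltW//|[-> _]//]] := eqVneq s r.
Qed.

Lemma unit_cell_disj r r' x : unit_cell r x -> unit_cell r' x -> r = r'.
Proof.
move=> h h'; apply: contrapT => /eqP rr'.
have := h r'; rewrite eq_sym => /(_ rr') [lt|[e lt]].
  by have [lt'|[e' _]] := h' r rr'; [have := lt_trans lt lt'|move: lt; rewrite e']; rewrite ltxx.
have [lt'|[_ lt']] := h' r rr'; first by move: lt'; rewrite e ltxx.
by have := ltn_trans lt lt'; rewrite ltnn.
Qed.

Lemma unit_cell_convex r : convex (unit_cell r).
Proof.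
move=> x y t hx hy t0 t1 s sr.
have [lx|hd] := hx s sr; last by right.
have [ly|hd] := hy s sr; last by right.
left; rewrite !form_convex; have [->|tn0] := eqVneq t 0.
  by rewrite subr0 !mul1r !mul0r !addr0.
by rewrite ler_ltD ?ler_wpM2l ?subr_ge0 ?(ltW lx) // ltr_pM2l // lt_def tn0.
Qed.

Lemma unit_cell_open r : linearly_open (unit_cell r).
Proof.
move=> x v hx.
have /choice[e he] : forall s, exists e : R, 0 < e /\
    (s != r -> forall t, 0 < t -> t < e -> beaten r s (x + t *: v)).
  move=> s; have [->|sr] := eqVneq s r; first by exists 1; split.
  have [lx|hd] := hx s sr; last by exists 1; split=> // _ t _ _; right.
  pose D := `|slope s v - slope r v|.
  have D1 : 0 < 1 + D by rewrite ltr_pwDl ?normr_ge0.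
  (* Before this time the competitor cannot make up its deficit; the summand 1 covers equal
     slopes. *)
  exists ((form r x - form s x) / (1 + D)); split.
    by rewrite divr_gt0 ?subr_gt0.
  move=> _ t t0; rewrite ltr_pdivlMr // => h; left; rewrite !form_line.
  have : t * (slope s v - slope r v) <= t * D by rewrite ler_wpM2l ?ler_norm ?ltW.
  move: h t0; rewrite mulrBr mulrDr mulr1 {D1}; move: (t * D) (t * _) (t * _) => a b1 b2.
  by move: (form r x) (form s x) (t : R) => u u' t'; lra.
exists (\big[Num.min/1]_s e s); first by apply: lt_bigmin => // s _; exact: (he s).1.
move=> t t0 te s sr; apply: (he s).2 => //; apply: lt_le_trans te _.
exact: bigmin_le.
Qed.

Lemma unit_cell_near r x : unit_cell r x -> \forall y \near x, unit_cell r y.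
Proof.
move=> hx; suff : nbhs x [set y | forall s : 'I_k, s != r -> beaten r s y] by [].
pose P (s : 'I_k) := [set y | s != r -> beaten r s y].
apply: (@filter_forall _ 'I_k P (nbhs x)) => s.
have [->|sr] := eqVneq s r; first by near=> y; rewrite /P /= eqxx.
have [lx|hd] := hx s sr; last by near=> y; move=> _; right.
have : \forall y \near x, form s y < form r y.
  have cD : continuous (fun y => form r y - form s y).
    by move=> y; apply: (@continuousB _ _ _ (form r) (form s)); exact: form_continuous.
  have : \forall z \near form r x - form s x, 0 < z.
    by apply: open_nbhs_nbhs; split; [exact: open_gt|rewrite /= subr_gt0].
  move=> /(cD x) pos; near=> y; rewrite -subr_gt0; near: y; exact: pos.
move=> lt_near; near=> y => _; left; near: y; exact: lt_near.
Unshelve. all: by end_near. Qed.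

End Unit.

(** One step with error at most [e * t] in each coordinate replaces a limit of difference quotients
    when slopes are compared. *)
Lemma diff_dir (R : realType) n m (f : 'rV[R]_n -> 'rV[R]_m) x v (e : R) :
  differentiable f x -> 0 < e ->
  exists2 t : R, 0 < t & forall i, `|f (x + t *: v) 0 i - f x 0 i - t * ('d f x v) 0 i| <= e * t.
Proof.
move=> df e0; have /eqaddoP := diff_locally df.
have d0 : 0 < e / (1 + `|v|) by rewrite divr_gt0 // ltr_pwDl.
move=> /(_ _ d0) /nbhs_ballP[r /= r0 hr].
pose t := r / (1 + `|v|) / 2.
have v1 : 0 < 1 + `|v| by rewrite ltr_pwDl.
have t0 : 0 < t by rewrite !divr_gt0.
exists t => // i.
have tE : t * (1 + `|v|) = r / 2 by rewrite /t; field; rewrite gt_eqF.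
have tvr : ball 0 r (t *: v).
  rewrite -ball_normE /= sub0r normrN normrZ gtr0_norm //.
  have -> : t * `|v| = r / 2 - t by rewrite -tE; ring.
  by lra.
have := hr _ tvr; rewrite !fctE /= [t *: v + x]addrC => h.
apply: le_trans (le_trans _ h) _.
  have -> : f (x + t *: v) 0 i - f x 0 i - t * ('d f x v) 0 i =
      (f (x + t *: v) - (f x + 'd f x (t *: v))) 0 i.
    have -> : 'd f x (t *: v) = t *: 'd f x v by rewrite linearZ.
    by rewrite !mxE; ring.
  by rewrite [leRHS]/Num.norm /= mx_normrE (le_bigmax _ _ (0, i)).
rewrite normrZ gtr0_norm //.
have -> : e / (1 + `|v|) * (t * `|v|) = (e * t) * (`|v| / (1 + `|v|)) by ring.
apply: ler_piMr; first by rewrite mulr_ge0 ?ltW.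
by rewrite ler_pdivrMr // mul1r lerDr.
Qed.

Lemma dependent_choice_fun (I : Type) (T : I -> Type) (P : forall i, T i -> Prop) :
  (forall i, exists s, P i s) -> exists s : forall i, T i, forall i, P i (s i).
Proof. by move=> h; exists (fun i => projT1 (cid (h i))) => i; exact: projT2 (cid (h i)). Qed.

(** * Regions of a layer as tuples of labels *)

Section Layer.
Variables (R : realType) (n m K : nat) (k : 'I_m -> nat).
Variables (A : forall j, 'M[R]_(k j, n)) (b : forall j, 'rV[R]_(k j)).
Hypothesis k_gt0 : forall i, (0 < k i)%N.
Hypothesis k_leK : forall i, (k i <= K.+1)%N.
Notation tup := {ffun 'I_m -> 'I_K.+1}.
Notation f := (maxout_layer A b).

(** Units of different ranks share the label type ['I_K.+1]; labels beyond the rank get empty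
    cells. *)
Definition label_cell i (r : 'I_K.+1) : set 'rV[R]_n :=
  [set x | exists2 s : 'I_(k i), (s = r :> nat) & unit_cell (A i) (b i) s x].

Lemma label_cell_disj i r r' x : label_cell i r x -> label_cell i r' x -> r = r'.
Proof.
by move=> [s sr hs] [s' sr' hs']; apply: val_inj; rewrite /= -sr -sr' (unit_cell_disj hs hs').
Qed.

Lemma label_cell_lt i r x : label_cell i r x -> (r < k i)%N.
Proof. by move=> [s <- _]. Qed.

Lemma label_cell_convex i r : convex (label_cell i r).
Proof.
move=> x y t [s sr hs] [s' sr' hs'] t0 t1.
have ss' : s' = s by apply: val_inj; rewrite /= sr sr'.
by exists s => //; apply: unit_cell_convex => //; rewrite -ss'.
Qed.

Lemma label_cell_open i r : linearly_open (label_cell i r).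
Proof.
move=> x v [s sr hs]; have [e e0 he] := unit_cell_open v hs.
by exists e => // t t0 te; exists s => //; exact: he.
Qed.

Definition region (c : tup) : set 'rV[R]_n := [set x | forall i, label_cell i (c i) x].

Lemma region_convex c : convex (region c).
Proof. by move=> x y t hx hy t0 t1 i; exact: label_cell_convex. Qed.

Lemma region_disj c c' x : region c x -> region c' x -> c = c'.
Proof. by move=> h h'; apply/ffunP => i; exact: label_cell_disj (h i) (h' i). Qed.

Lemma region_near c x : region c x -> \forall y \near x, region c y.
Proof.
move=> hx; pose P i := [set y | label_cell i (c i) y].
apply: (@filter_forall _ 'I_m P (nbhs x)) => i.
have [s sr hs] := hx i; near=> y; exists s => //; near: y; exact: unit_cell_near.
Unshelve. all: by end_near. Qed.

Lemma region_open c : open (region c).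
Proof. by rewrite openE => x hx; exact: region_near. Qed.

Lemma region_affine c x : region c x ->
  exists M v, forall y, region c y -> f y = y *m M + v.
Proof.
move=> hx.
have /dependent_choice_fun[s hs] : forall i, exists s : 'I_(k i), s = c i :> nat.
  by move=> i; have [s sr _] := hx i; exists s.
exists (\matrix_(j, i) A i (s i) j), (\row_i b i 0 (s i)) => y hy.
apply/rowP => i; rewrite !mxE.
have [s' sr' hs'] := hy i.
have ss' : s' = s i by apply: val_inj; rewrite /= sr' hs.
have -> : maxout_unit (A i) (b i) y = form (A i) (b i) (s i) y.
  by apply: maxout_eq => // s''; apply: unit_cell_le; rewrite -ss'.
by rewrite /form; congr (_ + _); apply: eq_bigr => j _; rewrite mxE mulrC.
Qed.

Lemma region_linear c x : region c x -> ~ nonlinear_locus f x.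
Proof.
move=> hx; have [M [v fM]] := region_affine hx.
have key y : region c y -> differentiable f y /\ jacobian f y = M.
  move=> hy; apply: near_affine_diff.
  by near=> z; apply: fM; near: z; exact: region_near.
move=> nl; apply: nl; split.
  by near=> y; apply: (key y _).1; near: y; exact: region_near.
apply: (@near_cst_continuous _ _ M).
by near=> y; apply: (key y _).2; near: y; exact: region_near.
Unshelve. all: by end_near. Qed.

(** An active form touches the unit from below, so its slope is at most the derivative in every
    direction; the direction [- v] gives the reverse inequality. *)
Lemma active_slope x i s v : differentiable f x ->
  maxout_unit (A i) (b i) x = form (A i) (b i) s x ->
  slope (A i) s v = ('d f x v) 0 i.
Proof.
move=> df mx.
have le w : slope (A i) s w <= ('d f x w) 0 i.
  rewrite leNgt; apply/negP => lt.
  pose e := (slope (A i) s w - ('d f x w) 0 i) / 2.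
  have e0 : 0 < e by rewrite divr_gt0 // subr_gt0.
  have [t t0 /(_ i)] := diff_dir w df e0.
  rewrite ler_norml => /andP[_]; rewrite !mxE mx.
  have := form_le_maxout (A i) (b i) (k_gt0 i) s (x + t *: w).
  rewrite form_line => h1 h2.
  have : t * slope (A i) s w - t * ('d f x w) 0 i <= e * t.
    by apply: le_trans h2; rewrite lerB // lerBrDr addrC.
  by rewrite -mulrBr mulrC ler_pM2r // /e; lra.
apply/eqP; rewrite eq_le le /=.
have := le (- v); rewrite linearN mxE /slope.
under eq_bigr do rewrite mxE mulrN.
by rewrite sumrN lerN2.
Qed.

(** The active forms of a unit at such a point share value and slope, hence coincide, and the one of
    least index owns the point. *)
Lemma differentiable_region x : differentiable f x -> exists c, region c x.
Proof.
move=> df.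
have /dependent_choice_fun[s hs] : forall i, exists s : 'I_(k i), unit_cell (A i) (b i) s x.
  move=> i; have [s0 s0P] := maxout_attained (A i) (b i) (k_gt0 i) x.
  have s0Q : form (A i) (b i) s0 x == maxout_unit (A i) (b i) x by rewrite s0P.
  pose top s := form (A i) (b i) s x == maxout_unit (A i) (b i) x.
  have [s /eqP sx smin] := @arg_minnP _ s0 top (fun s : 'I_(k i) => nat_of_ord s) s0Q.
  exists s => s' s's; have := form_le_maxout (A i) (b i) (k_gt0 i) s' x.
  rewrite le_eqVlt -sx => /orP[/eqP e|]; last by left.
  right; split; last first.
    by rewrite ltn_neqAle eq_sym (inj_eq val_inj) s's smin // /top e sx.
  move=> y; rewrite !(formE _ _ _ y).
  have E : slope (A i) s' =1 slope (A i) s.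
    by move=> v; rewrite !(active_slope v df) // -?sx ?e.
  rewrite E; congr (_ + _).
  by move: e; rewrite !(formE _ _ _ x) E => /addIr.
exists [ffun i => inord (s i)] => i; exists (s i) => //.
by rewrite ffunE inordK // (leq_trans (ltn_ord _)).
Qed.

Lemma linear_locusE : ~` nonlinear_locus f = \bigcup_c region c.
Proof.
apply/seteqP; split=> x; last by move=> [c _ /region_linear].
move=> /contrapT[/nbhs_singleton/differentiable_region[c hc] _].
by exists c.
Qed.

(** The sets [region c] are open, convex and disjoint and cover the complement of the locus, so the
    nonempty ones are its components. *)
Theorem num_regions : has_num_regions f #|realizable label_cell|.
Proof.
rewrite /has_num_regions.
have -> : linear_regions f = region @` [set` realizable label_cell].
  have comp c x : region c x -> connected_component (~` nonlinear_locus f) x = region c.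
    apply: open_cover_component; [exact: region_open| | |exact: linear_locusE].
      by move=> c'; apply/convex_connected/region_convex.
    exact: region_disj.
  apply/seteqP; split=> [_ [x xl <-]|_ [c + <-]].
    have [c _ hc] : (\bigcup_c region c) x by rewrite -linear_locusE.
    rewrite (comp c x hc).
    by exists c => //=; rewrite inE; apply/asboolP; exists x.
  rewrite /= inE => /asboolP[x hx]; exists x; last exact: comp.
  by rewrite linear_locusE; exists c.
apply: card_eq_trans (card_finset_II _).
apply: inj_card_eq => c c' /set_mem cD _ cc'.
move: cD; rewrite /= inE => /asboolP[x hx].
apply: (region_disj hx); rewrite -[region c']cc'; exact: hx.
Qed.

End Layer.

(** * The maximal number of regions *)

Section Comparisons.
Variables (R : realType) (e u : R) (k q s : nat).
Hypotheses (e0 : 0 < e) (qk : (q < k)%N) (sk : (s < k)%N) (sq : s != q).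

(** The difference factors as [(q - s) * (u - e * ((q + s + 1) / 2))], and in each case the two
    factors have the same sign. *)
Lemma label_up_lt : label_up e k q u ->
  s%:R * u - e * (s%:R * (s%:R + 1) / 2) < q%:R * u - e * (q%:R * (q%:R + 1) / 2).
Proof.
rewrite -subr_gt0.
have -> : q%:R * u - e * (q%:R * (q%:R + 1) / 2) - (s%:R * u - e * (s%:R * (s%:R + 1) / 2)) =
   (q%:R - s%:R) * (u - e * ((q%:R + s%:R + 1) / 2)) by ring.
case=> [->|[q0 u0]|[qE ku]].
- have -> : (q%:R - s%:R) * (e * (q%:R + 2^-1) - e * ((q%:R + s%:R + 1) / 2)) =
    e * ((q%:R - s%:R) ^+ 2 / 2) by field.
  by rewrite mulr_gt0 // divr_gt0 // exprn_even_gt0 //= subr_eq0 eqr_nat eq_sym.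
- have s0 : 0 < s%:R :> R by rewrite ltr0n; move: sq; rewrite q0; lia.
  rewrite q0 sub0r mulNr -mulrN mulr_gt0 // opprB subr_gt0 (le_lt_trans u0) //.
  by rewrite mulr_gt0 // divr_gt0 // add0r ltr_wpDl // ltW.
have sq' : (s < q)%N by move: sq; lia.
rewrite mulr_gt0 ?subr_gt0 ?ltr_nat // (le_lt_trans _ ku) // ler_pM2l //.
have : (q + s + 1)%:R <= (k + k)%:R :> R by rewrite ler_nat; lia.
by rewrite !natrD; lra.
Qed.

Lemma label_down_lt : label_down e k q u ->
  s%:R * u + e * (s%:R * (s%:R + 1) / 2) < q%:R * u + e * (q%:R * (q%:R + 1) / 2).
Proof.
rewrite -subr_gt0.
have -> : q%:R * u + e * (q%:R * (q%:R + 1) / 2) - (s%:R * u + e * (s%:R * (s%:R + 1) / 2)) =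
   (q%:R - s%:R) * (u + e * ((q%:R + s%:R + 1) / 2)) by ring.
case=> [k1|[qE u0]|[q0 ku]].
- by exfalso; move: sq qk sk; rewrite k1; lia.
- have sq' : (s < q)%N by move: sq; lia.
  have w0 : 0 <= e * ((q%:R + s%:R + 1) / 2) by rewrite mulr_ge0 ?divr_ge0 ?addr_ge0 ?(ltW e0).
  by rewrite mulr_gt0 ?subr_gt0 ?ltr_nat //; move: u0 w0; lra.
have s0 : 0 < s%:R :> R by rewrite ltr0n; move: sq; rewrite q0; lia.
rewrite q0 sub0r mulNr -mulrN mulr_gt0 // oppr_gt0 -ltrBrDr sub0r (lt_le_trans ku) //.
rewrite lerN2 ler_pM2l // add0r.
have : (s + 1)%:R <= (k + k)%:R :> R by rewrite ler_nat; lia.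
by rewrite !natrD; lra.
Qed.

End Comparisons.

Lemma mem_realizable (R : realType) n m K (k : 'I_m -> nat)
    (A : forall j, 'M[R]_(k j, n)) (b : forall j, 'rV[R]_(k j))
    (c : {ffun 'I_m -> 'I_K.+1}) x : (forall i, c i < k i)%N ->
  (forall i (q s : 'I_(k i)), q = c i :> nat -> s != q ->
     form (A i) (b i) s x < form (A i) (b i) q x) ->
  c \in realizable (label_cell A b).
Proof.
move=> ck h; rewrite inE; apply/asboolP; exists x => i.
by exists (Ordinal (ck i)) => // s sq; left; apply: h.
Qed.

Lemma flip_lt m K (k : 'I_m -> nat) d (a : {ffun 'I_m -> 'I_K.+1}) :
  (forall i, 0 < k i <= K.+1)%N -> (forall i, a i < k i)%N ->
  forall i, (flip k d a i < k i)%N.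
Proof. by move=> kK ak i; rewrite flip_val //; have := ak i; case: ifP => _; lia. Qed.

(** * Layers with biases *)

Section Biased.
Variables (R : realType) (n m : nat) (k : 'I_m -> nat).
Hypothesis k_gt0 : forall i, (0 < k i)%N.
Let K := (\max_i k i)%N.

Let kK i : (0 < k i <= K.+1)%N.
Proof. by rewrite k_gt0 /= leqW // leq_bigmax. Qed.

(** The input lists the coefficients of a polynomial below degree [n]. The bias adds the leading
    coefficient -1 and a quadratic term in [s], which spreads the breakpoints of a unit into
    parallel hyperplanes. *)
Definition parallel_weight (j : 'I_m) : 'M[R]_(k j, n) :=
  \matrix_(s, l) ((s : nat)%:R * node R j ^+ l).
Definition parallel_bias (e : R) (j : 'I_m) : 'rV[R]_(k j) :=
  \row_s (- ((s : nat)%:R * node R j ^+ n + e * ((s : nat)%:R * ((s : nat)%:R + 1) / 2))).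

Lemma parallel_form e j s (P : {poly R}) : (size P <= n.+1)%N -> P`_n = -1 ->
  form (parallel_weight j) (parallel_bias e j) s (\row_l P`_l) =
  (s : nat)%:R * P.[node R j] - e * ((s : nat)%:R * ((s : nat)%:R + 1) / 2).
Proof.
move=> sP Pn; rewrite /form (horner_coef_wide _ sP) big_ord_recr /= Pn mxE.
rewrite (eq_bigr (fun l : 'I_n => (s : nat)%:R * (P`_l * node R j ^+ l))); last first.
  by move=> l _; rewrite !mxE; ring.
by rewrite -mulr_sumr; ring.
Qed.

Theorem max_num_regions_biased : max_num_regions (@layers R n m k)
  (\sum_(0 <= j < n.+1) \sum_(S : {set 'I_m} | #|S| == j) \prod_(i in S) (k i - 1))%N.
Proof.
rewrite -(card_box_le _ kK).
have ub (A : forall j, 'M[R]_(k j, n)) (b : forall j, 'rV[R]_(k j)) :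
    (#|realizable (label_cell (K := K) A b)| <= #|box_le K k n|)%N.
  apply: (card_realizable k_gt0).
  - exact: label_cell_disj.
  - by move=> i r x; exact: label_cell_lt.
  - exact: label_cell_convex.
have reg (A : forall j, 'M[R]_(k j, n)) (b : forall j, 'rV[R]_(k j)) :
    has_num_regions (maxout_layer A b) #|realizable (label_cell (K := K) A b)|.
  by apply: num_regions => // i; case/andP: (kK i).
split; last first.
  by move=> _ [A [b ->]]; exists #|realizable (label_cell (K := K) A b)|; [exact: reg|exact: ub].
have [e e0 [he _]] := realize R n kK.
exists (maxout_layer parallel_weight (parallel_bias e)); first by
  exists parallel_weight, (parallel_bias e).
have /eqP -> : #|box_le K k n| ==
    #|realizable (label_cell (K := K) parallel_weight (parallel_bias e))|.
  rewrite eqn_leq ub andbT; apply: (card_flips0 (d := n) kK) => a ab.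
  have [P [sP Pn hP]] := he a ab.
  have ak i : (a i < k i)%N by move: ab; rewrite inE => /andP[/forallP].
  apply: (mem_realizable (x := \row_l P`_l)); first exact: flip_lt.
  move=> i q s qE sq; rewrite !parallel_form //.
  have := hP i; rewrite -qE; exact: label_up_lt.
exact: reg.
Qed.
End Biased.

(** * Layers without biases *)

Section Unbiased.
Variables (R : realType) (d m : nat) (k : 'I_m -> nat).
Hypothesis k_gt0 : forall i, (0 < k i)%N.
Let K := (\max_i k i)%N.

Let kK i : (0 < k i <= K.+1)%N.
Proof. by rewrite k_gt0 /= leqW // leq_bigmax. Qed.

Let b0 (j : 'I_m) : 'rV[R]_(k j) := 0.

Lemma form0Z p l (A : 'M[R]_(p, l)) s x a : form A 0 s (a *: x) = a * form A 0 s x.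
Proof.
rewrite /form !mxE !addr0 mulr_sumr; apply: eq_bigr => j _; rewrite mxE; ring.
Qed.

Lemma label_cell_cone (A : forall j, 'M[R]_(k j, d.+1)) i r : cone (label_cell (K := K) A b0 i r).
Proof.
move=> x a [s sr hs] a0; exists s => // s' /hs[lt|dup]; last by right.
by left; rewrite !form0Z ltr_pM2l.
Qed.

Definition effective (A : forall j, 'M[R]_(k j, d.+1)) : {set 'I_m} :=
  [set i | [exists s, exists s', row s (A i) != row s' (A i)]].

Lemma effective_wide A : effective A \subset wide k.
Proof.
apply/fintype.subsetP => i; rewrite !inE => /existsP[s /existsP[s' ne]].
rewrite ltnNge; apply: contra ne => k1; apply/eqP; congr row; apply: val_inj => /=.
by have := ltn_ord s; have := ltn_ord s'; lia.
Qed.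

Lemma row_form_eq p l (A : 'M[R]_(p, l)) s s' :
  (forall y, form A 0 s y = form A 0 s' y) -> row s A = row s' A.
Proof.
move=> h; apply/rowP => j; rewrite !mxE; have := h (delta_mx 0 j).
rewrite /form !mxE !addr0 (bigD1 j) //= [RHS](bigD1 j) //= !mxE !eqxx !mulr1.
by rewrite !big1 ?addr0 // => l' /negbTE lj; rewrite mxE lj andbF mulr0.
Qed.

Lemma effective_half_space A i r : i \in effective A ->
  exists h : 'cV[R]_d.+1, forall x, label_cell (K := K) A b0 i r x -> 0 < (x *m h) 0 0.
Proof.
rewrite inE => /existsP[s1 /existsP[s2 ne]].
have [rk|rk] := ltnP r (k i); last by exists 0 => x /label_cell_lt; rewrite ltnNge rk.
pose s := Ordinal rk.
have [s' s's] : exists s', row s' (A i) != row s (A i).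
  have [e|] := eqVneq (row s1 (A i)) (row s (A i)); last by exists s1.
  by exists s2; rewrite eq_sym -e.
(* On the cell of [s] this form strictly exceeds the different form of [s']. *)
exists (row s (A i) - row s' (A i))^T => x [q qr /(_ s')].
have -> : q = s by apply: val_inj.
move=> h; have [|lt|[dup _]] := h; last by case/eqP: s's; exact: row_form_eq.
  by apply: contraNneq s's => ->.
rewrite mxE (eq_bigr (fun j => A i s j * x 0 j - A i s' j * x 0 j)) => [|j _]; last first.
  by rewrite !mxE; ring.
by rewrite sumrB subr_gt0; move: lt; rewrite /form !mxE !addr0.
Qed.

(** All forms of the unit coincide and ties go to the least index, so only label 0 occurs. *)
Lemma ineffective_label A i : i \notin effective A ->
  exists r0 : 'I_K.+1, forall r x, label_cell A b0 i r x -> r = r0.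
Proof.
move=> ni; exists ord0 => r x [s sr hs]; apply: val_inj; rewrite /= -sr.
pose s0 := Ordinal (k_gt0 i).
have [->//|s0s] := eqVneq s s0.
have eqf y : form (A i) 0 s0 y = form (A i) 0 s y.
  rewrite /form; congr (_ + _); last by rewrite !mxE.
  apply: eq_bigr => j _; congr (_ * _).
  have /eqP /rowP/(_ j) : row s0 (A i) == row s (A i); last by rewrite !mxE.
  apply: contraNT ni => ne; rewrite inE; apply/existsP; exists s0.
  by apply/existsP; exists s.
have [|lt|[_ //]] := hs s0; first by rewrite eq_sym.
by move: lt; rewrite /b0 eqf ltxx.
Qed.

(** The leading coefficient is now an input and replaces the bias: it multiplies the quadratic term,
    and its values -1 and 1 lead to [label_up] and [label_down]. *)
Definition central_weight (e : R) (j : 'I_m) : 'M[R]_(k j, d.+1) :=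
  \matrix_(s, l) ((s : nat)%:R * node R j ^+ l +
    if l == d :> nat then e * ((s : nat)%:R * ((s : nat)%:R + 1) / 2) else 0).

Lemma central_form e j s (P : {poly R}) : (size P <= d.+1)%N ->
  form (central_weight e j) 0 s (\row_l P`_l) =
  (s : nat)%:R * P.[node R j] + P`_d * (e * ((s : nat)%:R * ((s : nat)%:R + 1) / 2)).
Proof.
move=> sP; rewrite /form (horner_coef_wide _ sP) mxE addr0 mulr_sumr.
set w := e * _.
rewrite (eq_bigr (fun l : 'I_d.+1 => (s : nat)%:R * (P`_l * node R j ^+ l) +
    (if l == d :> nat then w * P`_l else 0))); last first.
  by move=> l _; rewrite !mxE -/w; case: ifP => _; ring.
rewrite big_split /=; congr (_ + _).
rewrite big_ord_recr /= eqxx big1 ?add0r ?[w * _]mulrC // => l _.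
by rewrite ltn_eqF.
Qed.

Theorem max_num_regions_unbiased : max_num_regions (@layers_nobias R d.+1 m k)
  ((wide k != finset.set0) * 'C(#|wide k|.-1, d) +
   \sum_(0 <= j < d.+1) \sum_(S : {set 'I_m} | #|S| == j) \prod_(i in S) (k i - 1))%N.
Proof.
rewrite -(card_box_le _ kK).
have ub (A : forall j, 'M[R]_(k j, d.+1)) : (#|realizable (label_cell (K := K) A b0)| <=
    (wide k != finset.set0) * 'C(#|wide k|.-1, d) + #|box_le K k d|)%N.
  (* The bound is proved for the effective units, which are wide, and it is monotone in their
     number. *)
  apply: (@leq_trans ((effective A != finset.set0) * 'C(#|effective A|.-1, d) + #|box_le K k d|)%N).
    apply: (card_realizable_central k_gt0).
    - exact: label_cell_disj.
    - by move=> i r x; exact: label_cell_lt.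
    - exact: label_cell_convex.
    - exact: label_cell_cone.
    - exact: label_cell_open.
    - by move=> i r; exact: effective_half_space.
    - exact: ineffective_label.
  rewrite leq_add2r; have ew := effective_wide A.
  have [->|ne] := eqVneq (effective A) finset.set0; first by rewrite mul0n.
  have -> : wide k != finset.set0.
    by apply: contraNneq ne => w0; rewrite -finset.subset0 -w0.
  rewrite !mul1n leq_bin2l // -!subn1 leq_sub2r // subset_leq_card //.
have reg (A : forall j, 'M[R]_(k j, d.+1)) :
    has_num_regions (maxout_layer A b0) #|realizable (label_cell (K := K) A b0)|.
  by apply: num_regions => // i; case/andP: (kK i).
split; last first.
  by move=> _ [A ->]; exists #|realizable (label_cell (K := K) A b0)|; [exact: reg|exact: ub].
have [e e0 [hup hdown]] := realize R d kK.
exists (maxout_layer (central_weight e) b0); first by exists (central_weight e).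
have mem_up a : a \in box_le K k d ->
    flip k d a \in realizable (label_cell (K := K) (central_weight e) b0).
  move=> ab; have [P [sP Pd hP]] := hup a ab.
  have ak i : (a i < k i)%N by move: ab; rewrite inE => /andP[/forallP].
  apply: (mem_realizable (x := \row_l P`_l)); first exact: flip_lt.
  move=> i q s qE sq; rewrite /b0 !central_form // Pd !mulN1r.
  have := hP i; rewrite -qE; exact: label_up_lt.
have /eqP -> : ((wide k != finset.set0) * 'C(#|wide k|.-1, d) + #|box_le K k d|)%N ==
    #|realizable (label_cell (K := K) (central_weight e) b0)|.
  rewrite eqn_leq ub andbT; have [w0|[i1 iw1]] := set_0Vmem (wide k).
    by rewrite w0 eqxx mul0n add0n; exact: card_flips0 mem_up.
  have -> : wide k != finset.set0 by apply/set0Pn; exists i1.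
  have [i0 iw0 imin] := arg_minnP (fun i : 'I_m => nat_of_ord i) iw1.
  rewrite mul1n; apply: (card_flips kK iw0 mem_up) => T Tt.
  have [P [sP Pd hP]] := hdown i0 T iw0 imin Tt.
  apply: (mem_realizable (x := \row_l P`_l)).
    by apply: flip_lt => // i; exact: top_tup_lt.
  move=> i q s qE sq; rewrite /b0 !central_form // Pd !mul1r.
  have := hP i; rewrite -qE; exact: label_down_lt.
exact: reg.
Qed.
End Unbiased.

Lemma sum_equal_ranks m k l :
  (\sum_(0 <= j < l) \sum_(S : {set 'I_m} | #|S| == j) \prod_(i in S) (k - 1) =
   \sum_(0 <= j < l) 'C(m, j) * (k - 1) ^ j)%N.
Proof.
apply: eq_bigr => j _; rewrite (eq_bigr (fun=> (k - 1) ^ j)%N) => [|S /eqP <-].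
  by rewrite sum_nat_cond_const -[m in RHS]card_ord -card_draws.
by rewrite prod_nat_const.
Qed.

(** The factor [0 < w] is needed at [w = 0], where the truncated predecessor would give 1 for
    [d = 0]. *)
Lemma binz_pred w d : binz (Posz w - 1) d = ((0 < w) * 'C(w.-1, d))%N.
Proof. by case: w => [|w]; rewrite ?mul0n // mul1n -addn1 PoszD addrK addn1. Qed.

Theorem theorem3p6 (R : realType) (n m : nat) (hn : (1 <= n)%N) (hm : (1 <= m)%N) :
  (forall k : 'I_m -> nat, (forall i, (1 <= k i)%N) ->
     max_num_regions (@layers R n m k)
       (\sum_(0 <= j < n.+1) \sum_(S : {set 'I_m} | #|S| == j)
           \prod_(i in S) (k i - 1))%N)
  /\
  (forall k : nat, (1 <= k)%N ->
     max_num_regions (@layers R n m (fun _ => k))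
       (\sum_(0 <= j < n.+1) 'C(m, j) * (k - 1) ^ j)%N)
  /\
  (forall k : 'I_m -> nat, (forall i, (1 <= k i)%N) ->
     max_num_regions (@layers_nobias R n m k)
       (binz (Posz #|[set i : 'I_m | (1 < k i)%N]%SET| - 1)%R (n - 1)
        + \sum_(0 <= j < n) \sum_(S : {set 'I_m} | #|S| == j)
            \prod_(i in S) (k i - 1))%N)
  /\
  (forall k : nat, (1 < k)%N ->
     max_num_regions (@layers_nobias R n m (fun _ => k))
       ('C(m - 1, n - 1) + \sum_(0 <= j < n) 'C(m, j) * (k - 1) ^ j)%N).
Proof.
have unbiased : forall k : 'I_m -> nat, (forall i, (1 <= k i)%N) ->
     max_num_regions (@layers_nobias R n m k)
       (binz (Posz #|[set i : 'I_m | (1 < k i)%N]%SET| - 1)%R (n - 1)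
        + \sum_(0 <= j < n) \sum_(S : {set 'I_m} | #|S| == j)
            \prod_(i in S) (k i - 1))%N.
  case: n hn => // d _ k k0; rewrite subn1 /= binz_pred card_gt0.
  exact: max_num_regions_unbiased.
split; first by move=> k k0; exact: max_num_regions_biased.
split.
  by move=> k k0; rewrite -sum_equal_ranks; exact: (max_num_regions_biased R n (fun=> k0)).
split=> // k k1; rewrite -sum_equal_ranks.
have := unbiased (fun=> k) (fun=> ltnW k1).
rewrite (_ : [set i | (1 < k)%N]%SET = finset.setT) ?cardsT ?card_ord; last first.
  by apply/setP => i; rewrite !inE k1.
by rewrite binz_pred hm mul1n -subn1.
Qed.
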